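(* Let $C:\{0,1\}^n\times\{0,1\}^t\to\{0,1\}$ be a $(k,\epsilon)$-strong extractor with uniform seed and let $S_1,\dots,S_m\subset[d]$ be a weak $(t,r)$-design. Then Trevisan's extractor $\mathrm{Ext}_C:\{0,1\}^n\times\{0,1\}^d\to\{0,1\}^m$ is a quantum-proof $(k+rm+\log(1/\epsilon),\,3m\sqrt{\epsilon})$-strong extractor with uniform seed.
   Context: Logarithms base 2; $x_S$ denotes the bits of $x$ at positions in $S$; $\|A\|_{\mathrm{tr}}=\mathrm{tr}\sqrt{A^\dagger A}$; $\rho_{U_m}=2^{-m}\mathbb{1}$. Conditional min-entropy: $H_{\min}(A|B)_\rho=\max_{\sigma_B}\sup\{\lambda:2^{-\lambda}\mathbb{1}_A\otimes\sigma_B\ge\rho_{AB}\}$ over density operators $\sigma_B$; for trivial $B$ it is $-\log\max_x P_X(x)$. A function $\mathrm{Ext}:\{0,1\}^n\times\{0,1\}^d\to\{0,1\}^m$ is a $(k,\epsilon)$-strong extractor with uniform seed if for every random variable $X$ on $\{0,1\}^n$ with $H_{\min}(X)\ge k$ and $Y$ uniform on $\{0,1\}^d$ independent of $X$, $\frac12\|\rho_{\mathrm{Ext}(X,Y)Y}-\rho_{U_m}\otimes\rho_Y\|_{\mathrm{tr}}\le\epsilon$. It is a quantum-proof $(k,\epsilon)$-strong extractor with uniform seed if for every state $\rho_{XE}=\sum_xp_x|x\rangle\langle x|\otimes\rho^x_E$ classical on $X$ with $H_{\min}(X|E)_\rho\ge k$ and $Y$ uniform independent of $XE$, $\frac12\|\rho_{\mathrm{Ext}(X,Y)YE}-\rho_{U_m}\otimes\rho_Y\otimes\rho_E\|_{\mathrm{tr}}\le\epsilon$.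 Weak design: sets $S_1,\dots,S_m\subset[d]$ with $|S_i|=t$ and $\sum_{j=1}^{i-1}2^{|S_j\cap S_i|}\le rm$ for all $i$. Trevisan's extractor: $\mathrm{Ext}_C(x,y)=C(x,y_{S_1})\cdots C(x,y_{S_m})$. *)

(* Defs.v *)
From Stdlib Require Import Reals List Arith Sorted ClassicalEpsilon.
Open Scope R_scope.

Record Cx := mkCx { Re : R; Im : R }.
Definition C0 : Cx := mkCx 0 0.
Definition C1 : Cx := mkCx 1 0.
Definition Cadd (a b : Cx) : Cx := mkCx (Re a + Re b) (Im a + Im b).
Definition Copp (a : Cx) : Cx := mkCx (- Re a) (- Im a).
Definition Cmul (a b : Cx) : Cx :=
  mkCx (Re a * Re b - Im a * Im b) (Re a * Im b + Im a * Re b).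
Definition Cconj (a : Cx) : Cx := mkCx (Re a) (- Im a).
Definition RtoC (r : R) : Cx := mkCx r 0.

Fixpoint Csum (N : nat) (f : nat -> Cx) : Cx :=
  match N with O => C0 | S N' => Cadd (Csum N' f) (f N') end.
Fixpoint Rsumn (N : nat) (f : nat -> R) : R :=
  match N with O => 0 | S N' => Rsumn N' f + f N' end.

(** * Matrices: an N x N matrix is given by its entries at indices < N
    (entries outside the range are irrelevant to all notions below). *)
Definition Mat := nat -> nat -> Cx.
Definition mzero : Mat := fun _ _ => C0.
Definition madd (A B : Mat) : Mat := fun i j => Cadd (A i j) (B i j).
Definition msub (A B : Mat) : Mat := fun i j => Cadd (A i j) (Copp (B i j)).
Definition mscale (r : R) (A : Mat) : Mat := fun i j => Cmul (RtoC r) (A i j).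
Definition mmul (N : nat) (A B : Mat) : Mat :=
  fun i j => Csum N (fun l => Cmul (A i l) (B l j)).
Definition adj (A : Mat) : Mat := fun i j => Cconj (A j i).
Definition mtrace (N : nat) (A : Mat) : Cx := Csum N (fun i => A i i).
Definition mid : Mat := fun i j => if Nat.eqb i j then C1 else C0.
Definition proj (z : nat) : Mat :=
  fun i j => if andb (Nat.eqb i z) (Nat.eqb j z) then C1 else C0.
Fixpoint Msum (N : nat) (f : nat -> Mat) : Mat :=
  match N with O => mzero | S N' => madd (Msum N' f) (f N') end.
(** tensor product A (x) B, where B acts on a space of dimension nb;
    index (a, b) is encoded as a * nb + b *)
Definition kron (nb : nat) (A B : Mat) : Mat :=
  fun i j => Cmul (A (i / nb)%nat (j / nb)%nat) (B (i mod nb)%nat (j mod nb)%nat).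

Definition psd (N : nat) (A : Mat) : Prop :=
  forall v : nat -> Cx,
    let q := Csum N (fun i => Cmul (Cconj (v i))
                                   (Csum N (fun j => Cmul (A i j) (v j)))) in
    Im q = 0 /\ 0 <= Re q.
Definition loewner_le (N : nat) (A B : Mat) : Prop := psd N (msub B A).
Definition density (N : nat) (A : Mat) : Prop := psd N A /\ mtrace N A = C1.

Definition msqrt (N : nat) (P : Mat) : Mat :=
  epsilon (inhabits mzero)
    (fun B => psd N B /\ forall i j, (i < N)%nat -> (j < N)%nat ->
                                      mmul N B B i j = P i j).
Definition trnorm (N : nat) (A : Mat) : R :=
  Re (mtrace N (msqrt N (mmul N (adj A) A))).

Definition log2 (x : R) : R := ln x / ln 2.

Definition prob_dist (N : nat) (p : nat -> R) : Prop :=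
  (forall x, (x < N)%nat -> 0 <= p x) /\ Rsumn N p = 1.
Definition Hmin_cl (N : nat) (p : nat -> R) : R :=
  - log2 (fold_right Rmax 0 (map p (seq 0 N))).

Definition valid_cq (N dE : nat) (p : nat -> R) (rhoE : nat -> Mat) : Prop :=
  prob_dist N p /\ forall x, (x < N)%nat -> density dE (rhoE x).
Definition cq_matrix (N dE : nat) (p : nat -> R) (rhoE : nat -> Mat) : Mat :=
  Msum N (fun x => mscale (p x) (kron dE (proj x) (rhoE x))).
Definition marginalE (N : nat) (p : nat -> R) (rhoE : nat -> Mat) : Mat :=
  Msum N (fun x => mscale (p x) (rhoE x)).

(** H_min(A|B)_rho = max_sigma sup { lam | 2^-lam 1_A (x) sigma_B >= rho_AB },
    i.e. the supremum of all lam achievable with some density operator sigma *)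
Definition Hmin_q (NA dB : nat) (rho : Mat) : R :=
  epsilon (inhabits 0)
    (fun h => is_lub (fun lam => exists sigma, density dB sigma /\
        loewner_le (NA * dB) rho (mscale (Rpower 2 (- lam)) (kron dB mid sigma))) h).

(** * Extractors.  Bit strings of length l are encoded as naturals < 2^l;
    Ext : x -> y -> Ext(x,y). *)

Definition ext_out_cl (n d : nat) (p : nat -> R) (Ext : nat -> nat -> nat) : Mat :=
  Msum (2 ^ n) (fun x => Msum (2 ^ d) (fun y =>
    mscale (p x * / 2 ^ d) (kron (2 ^ d) (proj (Ext x y)) (proj y)))).
Definition ideal_cl (m d : nat) : Mat :=
  kron (2 ^ d) (mscale (/ 2 ^ m) mid) (mscale (/ 2 ^ d) mid).

Definition strong_ext (n d m : nat) (Ext : nat -> nat -> nat) (k eps : R) : Prop :=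
  forall p : nat -> R, prob_dist (2 ^ n) p -> k <= Hmin_cl (2 ^ n) p ->
    / 2 * trnorm (2 ^ m * 2 ^ d) (msub (ext_out_cl n d p Ext) (ideal_cl m d)) <= eps.

(** rho_{Ext(X,Y) Y E}, index ((z * 2^d + y) * dE + e) *)
Definition ext_out_q (n d dE : nat) (p : nat -> R) (rhoE : nat -> Mat)
    (Ext : nat -> nat -> nat) : Mat :=
  Msum (2 ^ n) (fun x => Msum (2 ^ d) (fun y =>
    mscale (p x * / 2 ^ d)
      (kron dE (kron (2 ^ d) (proj (Ext x y)) (proj y)) (rhoE x)))).
Definition ideal_q (n m d dE : nat) (p : nat -> R) (rhoE : nat -> Mat) : Mat :=
  kron dE (ideal_cl m d) (marginalE (2 ^ n) p rhoE).

Definition qproof_strong_ext (n d m : nat) (Ext : nat -> nat -> nat) (k eps : R) : Prop :=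
  forall (dE : nat) (p : nat -> R) (rhoE : nat -> Mat),
    valid_cq (2 ^ n) dE p rhoE ->
    k <= Hmin_q (2 ^ n) dE (cq_matrix (2 ^ n) dE p rhoE) ->
    / 2 * trnorm (2 ^ m * 2 ^ d * dE)
            (msub (ext_out_q n d dE p rhoE Ext) (ideal_q n m d dE p rhoE)) <= eps.

(** * Weak designs and Trevisan's extractor.
    Positions in [d] are 0-indexed as 0..d-1; a subset S_i is given as a
    strictly increasing list; sets are indexed 0..m-1. *)
Definition inter_size (s1 s2 : list nat) : nat :=
  length (filter (fun a => existsb (Nat.eqb a) s2) s1).

Definition weak_design (d t : nat) (r : R) (m : nat) (S : nat -> list nat) : Prop :=
  forall i, (i < m)%nat ->
    Sorted lt (S i) /\ length (S i) = t /\ (forall a, In a (S i) -> (a < d)%nat) /\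
    Rsumn i (fun j => 2 ^ inter_size (S j) (S i)) <= r * INR m.

(** little-endian: bit k of bits_to_nat l is the k-th element of l *)
Fixpoint bits_to_nat (l : list bool) : nat :=
  match l with nil => O | b :: l' => (Nat.b2n b + 2 * bits_to_nat l')%nat end.
Definition restrict (y : nat) (s : list nat) : nat :=
  bits_to_nat (map (Nat.testbit y) s).
Definition trevisan (C : nat -> nat -> bool) (S : nat -> list nat) (m : nat)
    (x y : nat) : nat :=
  bits_to_nat (map (fun i => C x (restrict y (S i))) (seq 0 m)).

(* Main.v *)
Require Import Defs.
From Stdlib Require Import Reals List Arith Sorted ClassicalEpsilon.
From Stdlib Require Import Lia Lra.
Open Scope R_scope.

(** Let R_x = p_x rho_x.  The trace norm of rho_{Ext(X,Y)YE} minus the ideal state is a sum of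
    terms Tr(R_x T_{z,y}) with contractions T_{z,y}, and a hybrid argument replaces the output bits
    one by one.  In the i-th step the seed bits outside S_i are frozen; the first i output bits then
    depend on x only through a table G(x) of at most r m bits, which acts as classical advice.

    For a one-bit extractor with advice, put rho_g = sum_{G x = g} R_x and let A_{u,g} be the same
    sum with signs (-1)^{C(x,u)}.  Cauchy-Schwarz bounds Tr(A T) by
    Tr(A rho_g^{-1/2} A rho_g^{-1/2}), which compares C(X,u) with C(Z,u), where Z is the outcome of
    the pretty good measurement on the side information (König and Terhal).  Given Z = z, either X
    still has min-entropy k, so that C extracts from it, or z lies in an event whose probability is
    bounded by the min-entropy of X given E. *)

(** * Bits of naturals and substitution of seed bits *)

(** Advice is paid for without a chain rule for min-entropy. There is one pretty good measurement
    for each advice value [g], and its effects sum to at most 1, so over all [g] they sum to at most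
    the number of advice values. Hence the bad event has probability at most [2^k lam 2^(r m)] when
    [R_x <= lam sigma] for all [x], and the extra [log(1/eps)] of entropy makes this of order [eps].

    The constant 3 arises per output bit. The extractor bounds the good columns by [2 eps]. The bad
    event costs another [2 eps] rather than [eps], because the supremum defining the min-entropy is
    only approached to within one bit. Cauchy-Schwarz, as AM-GM with weight [eps^(-1/2)], then gives
    [2 Tr(A T) <= eps^(-1/2) 4 eps + eps^(1/2) 2] after averaging over seeds and summing over [g].
    The last 2 is the trace 1 of the state plus 1 for a regularisation, needed since [rho_g] may be
    singular and has to be inverted. *)

Lemma testbit_bits_to_nat l k : Nat.testbit (bits_to_nat l) k = nth k l false.
Proof.
revert k; induction l as [|b l IH]; intros k.
  now simpl; rewrite Nat.bits_0; destruct k.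
change (bits_to_nat (b :: l)) with (Nat.b2n b + 2 * bits_to_nat l)%nat.
rewrite Nat.add_comm; destruct k as [|k].
  now destruct b; simpl Nat.b2n; [apply Nat.testbit_odd_0 | rewrite Nat.add_0_r; apply Nat.testbit_even_0].
simpl nth; rewrite <- IH; destruct b; simpl Nat.b2n; [apply Nat.testbit_odd_succ | rewrite Nat.add_0_r; apply Nat.testbit_even_succ]; lia.
Qed.

Lemma bits_to_nat_lt l : (bits_to_nat l < 2 ^ length l)%nat.
Proof. induction l as [|[] l IH]; simpl in *; lia. Qed.

Lemma testbit_ge a d k : (a < 2 ^ d)%nat -> (d <= k)%nat -> Nat.testbit a k = false.
Proof.
intros ha hk; rewrite <- (Nat.mod_small a (2 ^ d) ha).
now apply Nat.mod_pow2_bits_high.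
Qed.

Lemma testbit_eq_lt a b d : (a < 2 ^ d)%nat -> (b < 2 ^ d)%nat ->
  (forall k, (k < d)%nat -> Nat.testbit a k = Nat.testbit b k) -> a = b.
Proof.
intros ha hb e; apply Nat.bits_inj; intros k.
destruct (lt_dec k d) as [hk|hk]; [now apply e|].
rewrite (testbit_ge a d), (testbit_ge b d); auto; lia.
Qed.

Lemma mod_pow2_eq a b i :
  (a mod 2 ^ i = b mod 2 ^ i)%nat <->
  (forall k, (k < i)%nat -> Nat.testbit a k = Nat.testbit b k).
Proof.
assert (hz : (2 ^ i)%nat <> O) by (apply Nat.pow_nonzero; lia).
split; intros e.
  intros k hk; rewrite <- (Nat.mod_pow2_bits_low a i k hk), e.
  now apply Nat.mod_pow2_bits_low.
apply (testbit_eq_lt _ _ i); try (apply Nat.mod_upper_bound; assumption).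
intros k hk; rewrite !Nat.mod_pow2_bits_low; auto.
Qed.

Lemma mod_pow2S_eq a b i :
  (a mod 2 ^ Datatypes.S i = b mod 2 ^ Datatypes.S i)%nat <->
  (a mod 2 ^ i = b mod 2 ^ i)%nat /\ Nat.testbit a i = Nat.testbit b i.
Proof.
rewrite !mod_pow2_eq; split.
  intros e; split; [intros k hk|]; apply e; lia.
intros [e ei] k hk; destruct (Nat.eq_dec k i) as [->|]; [assumption|apply e; lia].
Qed.

Lemma testbit_restrict y s k : (k < length s)%nat ->
  Nat.testbit (restrict y s) k = Nat.testbit y (nth k s O).
Proof.
intros hk; unfold restrict; rewrite testbit_bits_to_nat.
rewrite (nth_indep _ false (Nat.testbit y O)) by (rewrite length_map; exact hk).
apply map_nth.
Qed.

Lemma restrict_lt y s : (restrict y s < 2 ^ length s)%nat.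
Proof. unfold restrict; rewrite <- (length_map (Nat.testbit y) s); apply bits_to_nat_lt. Qed.

Lemma trevisan_lt C S m x y : (trevisan C S m x y < 2 ^ m)%nat.
Proof.
unfold trevisan; set (l := map _ _).
replace m with (length l) by (unfold l; now rewrite length_map, length_seq).
apply bits_to_nat_lt.
Qed.

Lemma testbit_trevisan C S m x y i : (i < m)%nat ->
  Nat.testbit (trevisan C S m x y) i = C x (restrict y (S i)).
Proof.
intros hi; unfold trevisan; rewrite testbit_bits_to_nat.
set (f := fun i => C x (restrict y (S i))).
rewrite (nth_indep _ false (f O)) by (rewrite length_map, length_seq; exact hi).
now rewrite map_nth, seq_nth.
Qed.

(** * Overwriting the seed at the positions of one design set *)

Fixpoint position (a : nat) (s : list nat) : option nat :=
  match s with
  | nil => None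
  | b :: s' => if Nat.eqb a b then Some O else option_map Datatypes.S (position a s')
  end.

Lemma position_Some a s k : position a s = Some k ->
  (k < length s)%nat /\ nth k s O = a.
Proof.
revert k; induction s as [|b s IH]; intros k; simpl; [easy|].
destruct (Nat.eqb_spec a b) as [->|_].
  intros [= <-]; split; [lia | reflexivity].
destruct (position a s) as [k'|]; simpl; [|easy].
intros [= <-]; destruct (IH k' eq_refl); split; [lia | assumption].
Qed.

Lemma position_None a s : position a s = None <-> ~ In a s.
Proof.
induction s as [|b s IH]; simpl; [tauto|].
destruct (Nat.eqb_spec a b) as [->|hab]; [split; [easy|tauto]|].
destruct (position a s) as [k|]; simpl.
  split; [easy|]; intros h; destruct IH as [_ IH]; discriminate IH; tauto.
split; [|easy]; intros _ [h|h]; [congruence|]; now apply IH.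
Qed.

Lemma position_nth s k : NoDup s -> (k < length s)%nat -> position (nth k s O) s = Some k.
Proof.
intros nd hk; destruct (position (nth k s O) s) as [k'|] eqn:e.
  apply position_Some in e; destruct e as [hk' e].
  now rewrite (proj1 (NoDup_nth s O) nd k' k).
now apply position_None in e; destruct e; apply nth_In.
Qed.

Definition update (d y : nat) (s : list nat) (u : nat) : nat :=
  bits_to_nat (map (fun a => match position a s with
                             | Some k => Nat.testbit u k
                             | None => Nat.testbit y a
                             end) (seq 0 d)).

Lemma update_lt d y s u : (update d y s u < 2 ^ d)%nat.
Proof.
unfold update; set (l := map _ _).
replace d with (length l) by (unfold l; now rewrite length_map, length_seq).
apply bits_to_nat_lt.
Qed.

Lemma testbit_update d y s u a : (a < d)%nat ->
  Nat.testbit (update d y s u) a =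
  match position a s with Some k => Nat.testbit u k | None => Nat.testbit y a end.
Proof.
intros ha; unfold update; rewrite testbit_bits_to_nat.
set (f := fun a => match position a s with Some k => Nat.testbit u k | None => Nat.testbit y a end).
rewrite (nth_indep _ false (f O)) by (rewrite length_map, length_seq; exact ha).
now rewrite map_nth, seq_nth.
Qed.

Lemma restrict_update d y s u : NoDup s -> (forall a, In a s -> (a < d)%nat) ->
  (u < 2 ^ length s)%nat -> restrict (update d y s u) s = u.
Proof.
intros nd sd hu; apply (testbit_eq_lt _ _ (length s)); auto using restrict_lt.
intros k hk; rewrite testbit_restrict, testbit_update by auto using nth_In.
now rewrite position_nth.
Qed.

(** Together with [restrict_update] this makes [(y, u) |-> (update d y s u, restrict y s)] an
    involution, which is what [resample] needs. *)
Lemma update_restrict d y s u : (y < 2 ^ d)%nat ->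
  update d (update d y s u) s (restrict y s) = y.
Proof.
intros hy; apply (testbit_eq_lt _ _ d); auto using update_lt.
intros a ha; rewrite testbit_update by assumption.
destruct (position a s) as [k|] eqn:e.
  apply position_Some in e; destruct e as [hk e].
  now rewrite testbit_restrict, e.
now rewrite testbit_update, e.
Qed.

Definition inter (s1 s2 : list nat) : list nat :=
  filter (fun a => existsb (Nat.eqb a) s2) s1.

Lemma In_inter a s1 s2 : In a (inter s1 s2) <-> In a s1 /\ In a s2.
Proof.
unfold inter; rewrite filter_In, existsb_exists; split; intros [h h']; split; trivial.
  now destruct h' as [b [hb e]]; apply Nat.eqb_eq in e; subst b.
now exists a; split; [|apply Nat.eqb_refl].
Qed.

(** Outside [s2] the seed is frozen to [y], so the bits read at [s1] depend on [u] only through the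
    common positions. With [y] fixed, an output bit of Trevisan's extractor is thus a table with
    [2 ^ inter_size s1 s2] entries. *)
Lemma restrict_update_inter d y s1 s2 u : (forall a, In a s1 -> (a < d)%nat) ->
  restrict (update d y s2 u) s1 =
  restrict (update d y (inter s1 s2) (restrict (update d y s2 u) (inter s1 s2))) s1.
Proof.
intros sd; unfold restrict at 1 2; f_equal; apply map_ext_in; intros a ha.
rewrite (testbit_update d y (inter s1 s2)) by auto.
destruct (position a (inter s1 s2)) as [k|] eqn:e.
  apply position_Some in e; destruct e as [hk e].
  now rewrite testbit_restrict, e.
rewrite testbit_update by auto.
apply position_None in e.
destruct (position a s2) as [k|] eqn:e'; [exfalso|reflexivity].
apply position_Some in e'; destruct e' as [hk e'].
apply e, In_inter; split; trivial.
now rewrite <- e'; apply nth_In.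
Qed.

Lemma Sorted_lt_NoDup s : Sorted lt s -> NoDup s.
Proof.
intros h; apply Sorted_StronglySorted in h; [|exact Nat.lt_trans].
induction h as [|a s hs IH ha]; constructor; trivial.
intros hin; rewrite Forall_forall in ha; specialize (ha a hin); lia.
Qed.

Lemma mul_add_mod p b q : (q < b)%nat -> ((p * b + q) mod b = q)%nat.
Proof.
intros hq; rewrite Nat.add_comm, Nat.Div0.mod_add; now apply Nat.mod_small.
Qed.

Lemma mul_add_div p b q : (q < b)%nat -> ((p * b + q) / b = p)%nat.
Proof.
intros hq; rewrite Nat.add_comm, Nat.div_add by lia.
now rewrite Nat.div_small.
Qed.

(** * Real-valued min-entropy and rates *)

Lemma fold_Rmax_le l b : 0 <= b -> (forall x, In x l -> x <= b) -> fold_right Rmax 0 l <= b.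
Proof.
intros hb h; induction l as [|a l IH]; simpl; [exact hb|].
apply Rmax_lub; [apply h; now left|apply IH; intros x hx; apply h; now right].
Qed.

Lemma le_fold_Rmax l x : In x l -> x <= fold_right Rmax 0 l.
Proof.
induction l as [|a l IH]; simpl; [easy|]; intros [->|hx]; [apply Rmax_l|].
apply Rle_trans with (1 := IH hx); apply Rmax_r.
Qed.

Lemma Rsumn_le0 N p : (forall x, (x < N)%nat -> p x <= 0) -> Rsumn N p <= 0.
Proof.
induction N as [|N IH]; simpl; intros h; [lra|].
assert (hN := h N (Nat.lt_succ_diag_r N)).
assert (Rsumn N p <= 0) by (apply IH; intros; apply h; lia); lra.
Qed.

Lemma prob_dist_pos N p : prob_dist N p -> exists x, (x < N)%nat /\ 0 < p x.
Proof.
intros [h0 h1]; apply NNPP; intros hn.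
assert (Rsumn N p <= 0); [|lra].
apply Rsumn_le0; intros x hx; apply Rnot_lt_le; intros hp; apply hn; now exists x.
Qed.

Lemma ln2_pos : 0 < ln 2.
Proof. rewrite <- ln_1; apply ln_increasing; lra. Qed.

Lemma Rpower2_ge_inv c lam : 0 < c -> c <= Rpower 2 (- lam) -> lam <= - log2 c.
Proof.
intros hc h; assert (l2 := ln2_pos); unfold log2.
assert (hl : ln c <= - lam * ln 2).
  replace (- lam * ln 2) with (ln (Rpower 2 (- lam))) by (unfold Rpower; apply ln_exp).
  destruct h as [h| <-]; [now left; apply ln_increasing|now right].
apply Rmult_le_reg_r with (ln 2); trivial.
replace (- (ln c / ln 2) * ln 2) with (- ln c) by (field; lra); lra.
Qed.

Lemma Hmin_cl_ge N p k : prob_dist N p ->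
  (forall x, (x < N)%nat -> p x <= Rpower 2 (- k)) -> k <= Hmin_cl N p.
Proof.
intros hp h; unfold Hmin_cl; apply Rpower2_ge_inv.
  destruct (prob_dist_pos N p hp) as [x [hx px]]; apply Rlt_le_trans with (1 := px).
  apply le_fold_Rmax, in_map, in_seq; lia.
apply fold_Rmax_le; [unfold Rpower; apply Rlt_le, exp_pos|].
intros y hy; apply in_map_iff in hy; destruct hy as [x [<- hx]].
apply h; apply in_seq in hx; lia.
Qed.

(** Here [L] is the number of advice bits and [s] stands for [r m]. The [- 1] in the hypothesis on
    [lam] is the bit lost in [lub_approx], and it becomes the factor 2. *)
Lemma Rpower2_rate k s eps lam L : 0 < eps -> INR L <= s ->
  k + s + log2 (/ eps) - 1 < lam ->
  Rpower 2 (- lam) * 2 ^ L <= 2 * Rpower 2 (- k) * eps.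
Proof.
intros he hL hlam; assert (l2 := ln2_pos).
rewrite <- (Rpower_pow L 2) by lra.
rewrite <- (Rpower_1 2) at 3 by lra.
assert (e : eps = Rpower 2 (- log2 (/ eps))).
  unfold Rpower, log2; rewrite ln_Rinv by assumption.
  replace (- (- ln eps / ln 2) * ln 2) with (ln eps) by (field; lra).
  now rewrite exp_ln.
rewrite e.
rewrite <- !Rpower_plus; apply Rle_Rpower; lra.
Qed.

(** An optimal [sigma] for the min-entropy would require a compactness argument over density
    operators. Giving up one bit avoids it at the price of a factor 2. *)
Lemma lub_approx (E : R -> Prop) h : is_lub E h -> exists x, E x /\ h - 1 < x.
Proof.
intros [_ hl]; apply NNPP; intros hn; assert (h <= h - 1); [|lra].
apply hl; intros x hx; apply Rnot_lt_le; intros hlt; apply hn; now exists x.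
Qed.

From HB Require Import structures.
From mathcomp Require Import all_boot all_order all_algebra.
From mathcomp Require Import spectral sesquilinear ring.
Set Implicit Arguments. Unset Strict Implicit. Unset Printing Implicit Defensive.

(** * Positive semidefinite matrices *)

Section Psd.
Import Order.TTheory GRing.Theory Num.Theory.
Local Open Scope ring_scope.
Local Open Scope sesquilinear_scope.
Variable C : numClosedFieldType.

Definition hermmx n (A : 'M[C]_n) := A ^t* = A.
Definition psdmx n (A : 'M[C]_n) := forall v : 'rV_n, 0 <= (v *m A *m v ^t*) 0 0.

Lemma trmxCM m n p (A : 'M[C]_(m, n)) (B : 'M_(n, p)) :
  (A *m B) ^t* = B ^t* *m A ^t*.
Proof. by rewrite trmx_mul map_mxM. Qed.

Lemma trmxCD m n (A B : 'M[C]_(m, n)) : (A + B) ^t* = A ^t* + B ^t*.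
Proof. by rewrite linearD map_mxD. Qed.

Lemma trmxCB m n (A B : 'M[C]_(m, n)) : (A - B) ^t* = A ^t* - B ^t*.
Proof. by rewrite linearB map_mxB. Qed.

Lemma trmxCZ m n a (A : 'M[C]_(m, n)) : (a *: A) ^t* = a^* *: A ^t*.
Proof. by rewrite linearZ map_mxZ. Qed.

Lemma trmxC_sum m n I (r : seq I) (P : pred I) (F : I -> 'M[C]_(m, n)) :
  (\sum_(i <- r | P i) F i) ^t* = \sum_(i <- r | P i) (F i) ^t*.
Proof. by rewrite linear_sum map_mx_sum. Qed.

Lemma trmxC1 n : (1%:M : 'M[C]_n) ^t* = 1%:M.
Proof. by rewrite trmx1 map_mx1. Qed.

Lemma psd_congr n p (X : 'M[C]_(p, n)) (A : 'M_n) :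
  psdmx A -> psdmx (X *m A *m X ^t*).
Proof.
move=> pA v; have := pA (v *m X).
by rewrite trmxCM !mulmxA.
Qed.

Lemma psd_hermcongr n (X A : 'M[C]_n) : hermmx X -> psdmx A -> psdmx (X *m A *m X).
Proof. by move=> hX /(psd_congr X); rewrite hX. Qed.

Lemma psdD n (A B : 'M[C]_n) : psdmx A -> psdmx B -> psdmx (A + B).
Proof. by move=> pA pB v; rewrite mulmxDr mulmxDl mxE addr_ge0. Qed.

Lemma psdZ n a (A : 'M[C]_n) : 0 <= a -> psdmx A -> psdmx (a *: A).
Proof. by move=> a0 pA v; rewrite -scalemxAr -scalemxAl mxE mulr_ge0. Qed.

Lemma psd0 n : psdmx (0 : 'M[C]_n).
Proof. by move=> v; rewrite mulmx0 mul0mx mxE. Qed.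

Lemma psd_sum n I (r : seq I) (P : pred I) (F : I -> 'M[C]_n) :
  (forall i, P i -> psdmx (F i)) -> psdmx (\sum_(i <- r | P i) F i).
Proof. by move=> h; apply: big_ind => //; [exact: psd0 | exact: psdD]. Qed.

Lemma psd1 n : psdmx (1%:M : 'M[C]_n).
Proof.
move=> v; rewrite mulmx1 mxE; apply: sumr_ge0 => i _.
by rewrite !mxE mul_conjC_ge0.
Qed.

Lemma psd_gram m n (X : 'M[C]_(m, n)) : psdmx (X *m X ^t*).
Proof. by have := psd_congr X (@psd1 n); rewrite mulmx1. Qed.

Lemma psd_diag n (A : 'M[C]_n) i : psdmx A -> 0 <= A i i.
Proof.
move=> /(_ (delta_mx 0 i)); rewrite -rowE mxE (bigD1 i) //= big1 => [|j ji].
  by rewrite !mxE !eqxx rmorph1 mulr1 addr0.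
by rewrite !mxE (negbTE ji) andbF rmorph0 mulr0.
Qed.

Lemma psd_tr n (A : 'M[C]_n) : psdmx A -> 0 <= \tr A.
Proof. by move=> pA; apply: sumr_ge0 => i _; apply: psd_diag. Qed.

(** Polarisation: [0 <= z] forces [z] to be real, and the quadratic form at [e_i + c e_j] with
    [c = 1] and [c = 'i] shows that [A j i + A i j] and ['i * (A j i - A i j)] are real. *)
Lemma psd_herm n (A : 'M[C]_n) : psdmx A -> hermmx A.
Proof.
move=> pA; apply/matrixP => i j; rewrite !mxE.
have q c : ((A i i + c * A j i + (c^* * A i j + c * c^* * A j j)) \is Num.real).
  have := pA (delta_mx 0 i + c *: delta_mx 0 j).
  rewrite trmxCD trmxCZ mulmxDl -scalemxAl -!rowE mulmxDr mulmxDl mulmxDl.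
  rewrite -!scalemxAl -!scalemxAr !mxE.
  have tE k (k' : 'I_n) : \sum_j0 row k A 0 j0 * ((delta_mx (0:'I_1) k') ^t*) j0 (0:'I_1) = A k k'.
    rewrite (bigD1 k') //= big1 => [|l lk]; rewrite !mxE ?eqxx ?rmorph1 ?mulr1 ?addr0 //.
    by rewrite (negbTE lk) andbF rmorph0 mulr0.
  rewrite !tE => /ger0_real h.
  have tr (a b : C) : a = b -> a \is Num.real -> b \is Num.real by move=> ->.
  by apply: tr h; ring.
have rii k : A k k \is Num.real by apply/ger0_real/psd_diag.
have := q 1; rewrite rmorph1 !mul1r => q1.
have r1 : A j i + A i j \is Num.real.
  have -> : A j i + A i j = (A i i + A j i + (A i j + A j j)) - A i i - A j j by ring.
  by rewrite !rpredB.
have r2 : 'i * (A j i - A i j) \is Num.real.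
  have := q 'i; rewrite conjCi => q2.
  have -> : 'i * (A j i - A i j) =
    (A i i + 'i * A j i + (- 'i * A i j + 'i * - 'i * A j j)) - A i i - A j j.
    have i2 : 'i * - 'i = 1 :> C by rewrite mulrN -expr2 sqrCi opprK.
    by rewrite i2; ring.
  by rewrite !rpredB.
move/CrealP: r1; move/CrealP: r2; rewrite rmorphM /= conjCi rmorphB rmorphD /=.
rewrite mulNr -mulrN opprB => /(mulfI (neq0Ci C)) e2 e1.
apply: (mulfI (_ : 2 != 0 :> C)); first by rewrite pnatr_eq0.
rewrite !mulr_natl !mulr2n -{1}(addrK ((A i j)^*) ((A j i)^*)) e1.
have -> : (A j i)^* = (A i j)^* - (A j i - A i j) by rewrite -e2; ring.
by ring.
Qed.

(** The last clause expresses the eigenvalues through the quadratic form of [A], so their sign or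
    realness can be read off from [A] directly. *)
Lemma herm_spectral n (A : 'M[C]_n) : hermmx A ->
  exists (P : 'M[C]_n) (X : 'rV[C]_n),
    [/\ P *m P ^t* = 1%:M, P ^t* *m P = 1%:M, A = P ^t* *m diag_mx X *m P
      & forall i, X 0 i = (row i P *m A *m (row i P) ^t*) 0 0].
Proof.
move=> hA; have /orthomx_spectralP : A \is normalmx.
  by apply/normalmxP; rewrite hA.
set P := spectralmx A; set X := spectral_diag A => eA.
have uP : P \is unitarymx := spectral_unitarymx A.
rewrite (invmx_unitary uP) in eA.
have PP : P *m P ^t* = 1%:M by apply/unitarymxP.
have PP' := mulmx1C PP.
exists P, X; split=> // i.
rewrite [in RHS]eA !rowE !mulmxA -(mulmxA (delta_mx 0 i)) PP mulmx1 trmxCM.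
rewrite !mulmxA -(mulmxA _ P) PP mulmx1 -rowE row_diag_mx -scalemxAl.
rewrite mxE -rowE mxE !mxE !eqxx rmorph1 mulr1 //.
Qed.

Lemma diag_mx_trmxC n (X : 'rV[C]_n) :
  (forall i, X 0 i \is Num.real) -> hermmx (diag_mx X).
Proof.
move=> rX; apply/matrixP => i j; rewrite !mxE eq_sym.
case: eqP => [->|_]; rewrite ?mulr0n ?rmorph0 // mulr1n.
exact/CrealP.
Qed.

Lemma psd_diag_mx n (X : 'rV[C]_n) : (forall i, 0 <= X 0 i) -> psdmx (diag_mx X).
Proof.
move=> X0 v; rewrite mxE; apply: sumr_ge0 => j _.
by rewrite mul_mx_diag !mxE mulrAC mulr_ge0 // mul_conjC_ge0.
Qed.

Lemma spectral_mul n (P : 'M[C]_n) (X Y : 'rV[C]_n) : P *m P ^t* = 1%:M ->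
  (P ^t* *m diag_mx X *m P) *m (P ^t* *m diag_mx Y *m P)
  = P ^t* *m diag_mx (\row_i (X 0 i * Y 0 i)) *m P.
Proof.
move=> PP; rewrite !mulmxA -(mulmxA _ P) PP mulmx1 -(mulmxA (P ^t*)).
by rewrite mulmx_diag.
Qed.

Lemma psd_spectral n (P : 'M[C]_n) (X : 'rV[C]_n) :
  (forall i, 0 <= X 0 i) -> psdmx (P ^t* *m diag_mx X *m P).
Proof. by move=> X0; have := psd_congr (P ^t*) (psd_diag_mx X0); rewrite trmxCK. Qed.

Lemma psd_sqrt n (A : 'M[C]_n) : psdmx A -> exists2 B, psdmx B & B *m B = A.
Proof.
move=> pA; have [P [X [PP PP' eA eX]]] := herm_spectral (psd_herm pA).
have X0 i : 0 <= X 0 i by rewrite eX.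
exists (P ^t* *m diag_mx (\row_i sqrtC (X 0 i)) *m P).
  by apply: psd_spectral => i; rewrite mxE sqrtC_ge0.
rewrite spectral_mul // eA; congr (_ *m diag_mx _ *m _).
by apply/rowP => i; rewrite !mxE -expr2 sqrtCK.
Qed.

Lemma psd_tr_mul n (A B : 'M[C]_n) : psdmx A -> psdmx B -> 0 <= \tr (A *m B).
Proof.
move=> /psd_sqrt[X pX <-] pB; rewrite -mulmxA mxtrace_mulC.
by apply: psd_tr; apply: psd_hermcongr => //; apply: psd_herm.
Qed.

Lemma tr_gram_eq0 m n (X : 'M[C]_(m, n)) : \tr (X *m X ^t*) = 0 -> X = 0.
Proof.
have sq i j : 0 <= X i j * (X ^t*) j i by rewrite !mxE mul_conjC_ge0.
move/eqP; rewrite psumr_eq0 => [/allP h|i _]; last by rewrite mxE sumr_ge0.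
apply/matrixP => i j; have := h i (mem_index_enum _); rewrite mxE psumr_eq0 //.
by move=> /allP/(_ j (mem_index_enum _)); rewrite !mxE mul_conjC_eq0 => /eqP.
Qed.

Lemma psd_tr_eq0 n (A : 'M[C]_n) : psdmx A -> \tr A = 0 -> A = 0.
Proof.
move=> /psd_sqrt[B /psd_herm hB <-]; rewrite -{2}hB => /tr_gram_eq0 ->.
by rewrite mul0mx.
Qed.

(* For X = B - D, XB + DX = 0, so tr(XBX) + tr(XDX) = 0 and X^3 = XBX - XDX = 0. *)
Lemma psd_sqrt_uniq n (B D : 'M[C]_n) :
  psdmx B -> psdmx D -> B *m B = D *m D -> B = D.
Proof.
move=> pB pD e; set X := B - D.
have hX : hermmx X by rewrite /X /hermmx trmxCB (psd_herm pB) (psd_herm pD).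
have z : X *m B + D *m X = 0.
  by rewrite /X mulmxBl mulmxBr -e addrA subrK subrr.
have pXB := psd_hermcongr hX pB; have pXD := psd_hermcongr hX pD.
have tz : \tr (X *m B *m X) + \tr (X *m D *m X) = 0.
  rewrite [\tr (X *m B *m X)]mxtrace_mulC -[X *m D *m X]mulmxA -mxtraceD -mulmxDr z.
  by rewrite mulmx0 mxtrace0.
move/eqP: tz; rewrite paddr_eq0 ?psd_tr // => /andP[/eqP t1 /eqP t2].
have X3 : X *m X *m X = 0.
  have -> : X *m X *m X = X *m B *m X - X *m D *m X by rewrite -mulmxBl -mulmxBr.
  rewrite (psd_tr_eq0 pXB t1) (psd_tr_eq0 pXD t2).
  by rewrite subr0.
have X2 : X *m X = 0.
  by apply: tr_gram_eq0; rewrite trmxCM hX mulmxA X3 mul0mx mxtrace0.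
suff /eqP : X = 0 by rewrite subr_eq0 => /eqP.
by apply: tr_gram_eq0; rewrite hX X2 mxtrace0.
Qed.

(** The Hermitian [T] with [-1 <= T <= 1], the test operators dual to the trace norm. In this form
    averages and compressions of contractions are contractions by linearity. *)
Definition contraction n (T : 'M[C]_n) := psdmx (1%:M - T) /\ psdmx (1%:M + T).

Lemma contraction_herm n (T : 'M[C]_n) : contraction T -> hermmx T.
Proof.
case=> _ /psd_herm; rewrite /hermmx trmxCD trmxC1 => /eqP.
by rewrite (inj_eq (addrI _)) => /eqP.
Qed.

(* 2 (1 - T^2) = (1-T)(1+T)(1-T) + (1+T)(1-T)(1+T). *)
Lemma contraction_sqr n (T : 'M[C]_n) : contraction T -> psdmx (1%:M - T *m T).
Proof.
move=> cT; have hT := contraction_herm cT; case: cT => pm pp.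
have h1 : hermmx (1%:M - T) by apply: psd_herm.
have h2 : hermmx (1%:M + T) by apply: psd_herm.
have := psdD (psd_hermcongr h1 pp) (psd_hermcongr h2 pm).
have e1 : (1%:M - T) *m (1%:M + T) = 1%:M - T *m T.
  by rewrite mulmxDr mulmx1 mulmxBl mul1mx addrA subrK.
have e2 : (1%:M + T) *m (1%:M - T) = 1%:M - T *m T.
  by rewrite mulmxDl mul1mx mulmxBr mulmx1 addrA subrK.
rewrite e1 e2 -mulmxDr addrACA addNr addr0 => /(psdZ (a := 2^-1)).
rewrite invr_ge0 ler0n => /(_ isT); rewrite scalemxAr -mulr2n -scaler_nat scalerA.
by rewrite mulVf ?pnatr_eq0 // scale1r mulmx1.
Qed.

Lemma contraction_tr n (T A : 'M[C]_n) :
  contraction T -> psdmx A -> \tr (A *m T *m T) <= \tr A.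
Proof.
move=> /contraction_sqr cT pA; have := psd_tr_mul pA cT.
by rewrite mulmxBr mulmx1 raddfB subr_ge0 mulmxA.
Qed.

Lemma contraction_opp n (T : 'M[C]_n) : contraction T -> contraction (- T).
Proof. by case=> p1 p2; split; rewrite ?opprK. Qed.

Lemma contraction_avg n (I : finType) (P : pred I) (c : C) (F : I -> 'M[C]_n) :
  (forall i, P i -> contraction (F i)) -> 0 <= c -> c * (\sum_(i | P i) 1) = 1 ->
  contraction (c *: \sum_(i | P i) F i).
Proof.
move=> cF c0 c1.
have e : 1%:M = c *: \sum_(i | P i) (1%:M : 'M[C]_n).
  rewrite -[in LHS](scale1r 1%:M) -c1 -scalerA; congr (_ *: _).
  by rewrite scaler_suml; apply: eq_bigr => i _; rewrite scale1r.
split; rewrite [in 1%:M]e -?scalerBr -?scalerDr -?sumrB -?big_split /=.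
  by apply: psdZ => //; apply: psd_sum => i /cF[].
by apply: psdZ => //; apply: psd_sum => i /cF[].
Qed.

Lemma contraction0 n : contraction (0 : 'M[C]_n).
Proof. by split; rewrite ?subr0 ?addr0; apply: psd1. Qed.

Lemma contraction_compress n p (V : 'M[C]_(p, n)) (T : 'M[C]_n) :
  V *m V ^t* = 1%:M -> contraction T -> contraction (V *m T *m V ^t*).
Proof.
move=> VV [/(psd_congr V) p1 /(psd_congr V) p2]; split.
  by move: p1; rewrite mulmxBr mulmxBl mulmx1 VV.
by move: p2; rewrite mulmxDr mulmxDl mulmx1 VV.
Qed.

(** [B] is the absolute value of [A] and [T] its sign in an eigenbasis, with sign 1 at the
    eigenvalue 0. So [T] attains the trace norm. *)
Lemma herm_abs n (A : 'M[C]_n) : hermmx A ->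
  exists B T : 'M[C]_n, [/\ psdmx B, B *m B = A *m A, contraction T & \tr B = \tr (A *m T)].
Proof.
move=> hA; have [P [X [PP PP' eA eX]]] := herm_spectral hA.
have rX i : X 0 i \is Num.real.
  rewrite eX CrealE; apply/eqP.
  have e : ((row i P *m A *m (row i P) ^t*) ^t*) 0 0 = (row i P *m A *m (row i P) ^t*) 0 0.
    by rewrite !trmxCM trmxCK hA mulmxA.
  by rewrite -[in RHS]e [in RHS]mxE [in RHS]mxE.
pose sg i : C := if 0 <= X 0 i then 1 else -1.
have sgX i : X 0 i * sg i = `|X 0 i|.
  rewrite /sg; have [h|h] := real_leP (@real0 _) (rX i); first by rewrite mulr1 ger0_norm.
  by rewrite mulrN1 ltr0_norm.
exists (P ^t* *m diag_mx (\row_i `|X 0 i|) *m P), (P ^t* *m diag_mx (\row_i sg i) *m P).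
have PD c : P ^t* *m diag_mx (\row__ c) *m P = c *: 1%:M.
  rewrite -PP' scalemxAl; congr (_ *m _).
  have -> : diag_mx (\row__ c) = c%:M :> 'M[C]_n by apply/matrixP => i j; rewrite !mxE.
  by rewrite mul_mx_scalar.
split.
- by apply: psd_spectral => i; rewrite mxE.
- rewrite spectral_mul // [in RHS]eA spectral_mul //; congr (_ *m diag_mx _ *m _).
  by apply/rowP => i; rewrite !mxE -expr2 real_normK // expr2.
- split.
    have -> : 1%:M - P ^t* *m diag_mx (\row_i sg i) *m P =
       P ^t* *m diag_mx (\row_i (1 - sg i)) *m P.
      rewrite -[X in X - _]scale1r -PD -mulmxBl -mulmxBr -raddfB.
      by congr (_ *m diag_mx _ *m _); apply/rowP => i; rewrite !mxE.
    apply: psd_spectral => i; rewrite mxE /sg; case: ifP => _; first by rewrite subrr.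
    by rewrite opprK addr_ge0.
  have -> : 1%:M + P ^t* *m diag_mx (\row_i sg i) *m P =
     P ^t* *m diag_mx (\row_i (1 + sg i)) *m P.
    rewrite -[X in X + _]scale1r -PD -mulmxDl -mulmxDr -raddfD.
    by congr (_ *m diag_mx _ *m _); apply/rowP => i; rewrite !mxE.
  apply: psd_spectral => i; rewrite mxE /sg; case: ifP => _; last by rewrite subrr.
  by rewrite addr_ge0.
- rewrite [in RHS]eA spectral_mul //; congr (\tr (_ *m diag_mx _ *m _)).
  by apply/rowP => i; rewrite !mxE sgX.
Qed.

End Psd.

(** * One-bit extractors with advice against quantum side information *)

Section KonigTerhal.
Import Order.TTheory GRing.Theory Num.Theory.
Local Open Scope ring_scope.
Local Open Scope sesquilinear_scope.
Variable C : numClosedFieldType.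

(** On the kernel of [A] the form of [A - d] is [-d] times the squared norm, so positivity leaves
    only the zero vector. *)
Lemma psd_unitmx n (A : 'M[C]_n) d : 0 < d -> psdmx (A - d%:M) -> A \in unitmx.
Proof.
move=> d0 pA; rewrite -row_free_unit -kermx_eq0; apply/eqP.
have := psd_tr (psd_congr (kermx A) pA).
rewrite mulmxBr mulmx_ker sub0r mul_mx_scalar mulNmx -scalemxAl raddfN /= mxtraceZ /=.
rewrite oppr_ge0 pmulr_rle0 // => h; apply: tr_gram_eq0.
by apply/eqP; rewrite eq_le h psd_tr //; apply: psd_gram.
Qed.

Lemma invmx_herm n (K : 'M[C]_n) : K \in unitmx -> hermmx K -> hermmx (invmx K).
Proof.
move=> uK hK; rewrite /hermmx; set M := invmx K.
rewrite -[LHS]mulmx1 -(mulmxV uK) mulmxA -{1}hK -trmxCM mulmxV //.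
by rewrite trmxC1 mul1mx.
Qed.

(** The right side minus the left is half the squared Hilbert-Schmidt norm of the commutator of [L]
    and [T]. *)
Lemma herm_swap_tr n (L T : 'M[C]_n) : hermmx L -> hermmx T ->
  \tr (L *m T *m L *m T) <= \tr (L *m L *m T *m T).
Proof.
move=> hL hT; pose Z := L *m T - T *m L.
have := psd_tr (psd_gram Z).
have -> : Z ^t* = T *m L - L *m T by rewrite trmxCB !trmxCM hL hT.
rewrite /Z mulmxBl !mulmxBr !raddfB /= !mulmxA.
have -> : \tr (L *m T *m T *m L) = \tr (L *m L *m T *m T).
  by rewrite mxtrace_mulC !mulmxA.
have -> : \tr (T *m L *m L *m T) = \tr (L *m L *m T *m T).
  by rewrite -!mulmxA mxtrace_mulC !mulmxA.
have -> : \tr (T *m L *m T *m L) = \tr (L *m T *m L *m T).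
  by rewrite -!mulmxA mxtrace_mulC !mulmxA.
set a := \tr _; set b := \tr _ => h.
have {h} : 0 <= 2 * (a - b) by apply: le_trans h _; rewrite le_eqVlt; apply/orP; left; apply/eqP; ring.
by rewrite pmulr_rge0 ?ltr0n // subr_ge0.
Qed.

(* [W] is the inverse square root of [rho + d], so that the matrices [W R W] for [rho = sum R] form
   the pretty good measurement.  The trace bound is Cauchy-Schwarz for
   A T = (M A M) (K T K) with K^4 = rho + d and M = K^-1, in AM-GM form. *)
Lemma pretty_good n (rho : 'M[C]_n) d : 0 < d -> psdmx rho ->
  exists W : 'M[C]_n, [/\ hermmx W, psdmx (1%:M - W *m rho *m W) &
    forall A T c, hermmx A -> contraction T -> 0 < c ->
      2 * \tr (A *m T) <= c * \tr (A *m W *m A *m W) + c^-1 * (\tr rho + d *+ n)].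
Proof.
move=> d0 prho; set tau := rho + d%:M.
have pd : psdmx (d%:M : 'M[C]_n).
  by rewrite -scalemx1; apply: psdZ (ltW d0) (@psd1 _ _).
have ptau : psdmx tau by apply: psdD.
have utau : tau \in unitmx by apply: (psd_unitmx d0); rewrite /tau addrK.
have [L pL eL] := psd_sqrt ptau; have [K pK eK] := psd_sqrt pL.
have uL : L \in unitmx by move: utau; rewrite -eL unitmx_mul => /andP[].
have uK : K \in unitmx by move: uL; rewrite -eK unitmx_mul => /andP[].
have hK := psd_herm pK; have hL := psd_herm pL.
have hM := invmx_herm uK hK; set M := invmx K in hM.
have MK : M *m K = 1%:M by rewrite mulVmx.
have KM : K *m M = 1%:M by rewrite mulmxV.
have hW : hermmx (M *m M) by rewrite /hermmx trmxCM hM.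
have WtW : M *m M *m tau *m (M *m M) = 1%:M.
  rewrite -eL -eK !mulmxA -(mulmxA _ M K) MK mulmx1 MK mul1mx.
  by rewrite -(mulmxA _ K M) KM mulmx1 KM.
exists (M *m M); split=> //.
  (* Since [W tau W = 1], the defect [1 - W rho W] is [W d W]: the measurement is incomplete only by
     the regularisation. *)
  rewrite -[X in X - _]WtW -mulmxBl -mulmxBr /tau addrC addKr.
  exact: psd_hermcongr.
move=> A T c hA cT c0; have hT := contraction_herm cT.
pose X := M *m A *m M; pose Y := K *m T *m K.
have hX : hermmx X by rewrite /hermmx /X !trmxCM hM hA mulmxA.
have hY : hermmx Y by rewrite /hermmx /Y !trmxCM hK hT mulmxA.
have eXY : \tr (X *m Y) = \tr (A *m T).
  rewrite /X /Y !mulmxA -(mulmxA _ M K) MK mulmx1 mxtrace_mulC !mulmxA KM.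
  by rewrite mul1mx.
have eYX : \tr (Y *m X) = \tr (A *m T) by rewrite mxtrace_mulC.
have eXX : \tr (X *m X) = \tr (A *m (M *m M) *m A *m (M *m M)).
  by rewrite /X -!mulmxA mxtrace_mulC !mulmxA.
have eYY : \tr (Y *m Y) <= \tr rho + d *+ n.
  have -> : \tr (Y *m Y) = \tr (L *m T *m L *m T).
    rewrite /Y -eK -!mulmxA mxtrace_mulC !mulmxA.
    by rewrite -!mulmxA mxtrace_mulC !mulmxA.
  (* Moving the two [L] together restores [tau = L^2], and then [T^2 <= 1] removes [T]. *)
  apply: le_trans (herm_swap_tr hL hT) _; rewrite eL.
  by apply: le_trans (contraction_tr cT ptau) _; rewrite /tau mxtraceD mxtrace_scalar.
(* AM-GM: expand the trace of the square of [c X - Y] and divide by [c]. *)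
have := psd_tr (psd_gram (c *: X - Y)).
have c0' : c^* = c by apply/CrealP; apply: gtr0_real.
rewrite trmxCB trmxCZ hX hY c0' mulmxBl !mulmxBr !raddfB /=.
rewrite -!scalemxAl -!scalemxAr !mxtraceZ /= eXY eYX eXX => h.
rewrite -(ler_pM2l c0) mulrDr (mulrA c c^-1) mulfV ?gt_eqF // mul1r.
rewrite -subr_ge0; apply: le_trans h _.
rewrite -subr_ge0 (_ : _ - _ = \tr rho + d *+ n - \tr (Y *m Y)) ?subr_ge0 //.
by ring.
Qed.

Section Advice.
Variables (X U gT : finType) (n : nat) (R : X -> 'M[C]_n) (b : X -> U -> bool).
Variables (sigma : 'M[C]_n) (lam kap e : C) (G : X -> gT) (T : U -> gT -> 'M[C]_n).
Hypothesis psdR : forall x, psdmx (R x).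
Hypothesis trR : \sum_x \tr (R x) = 1.
Hypothesis tr_sigma : \tr sigma = 1.
Hypothesis psd_sigma : psdmx sigma.
Hypothesis le_sigma : forall x, psdmx (lam *: sigma - R x).
Hypothesis contrT : forall u g, contraction (T u g).
Hypothesis kap_gt0 : 0 < kap.
Hypothesis e_gt0 : 0 < e.
(** One-bit extraction in terms of biases. For a single output bit the trace norm is the mean over
    seeds of the absolute bias, and the half in the definition of the distance yields the 2. *)
Hypothesis extractor : forall q : X -> C, (forall x, 0 <= q x) -> \sum_x q x = 1 ->
  (forall x, q x <= kap) ->
  \sum_u `|\sum_x q x * (-1) ^+ b x u| <= 2 * e * #|U|%:R.
Hypothesis lamG : lam * #|gT|%:R <= 2 * kap * e.

Lemma gT_gt0 : (0 < #|gT|)%N.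
Proof.
have [x _|X0] := pickP (@predT X); first by apply/card_gt0P; exists (G x).
by move: trR; rewrite big_pred0 // => /esym/eqP; rewrite oner_eq0.
Qed.

Lemma dim_gt0 : (0 < n)%N.
Proof.
case: n sigma tr_sigma => // sg; rewrite /mxtrace big_ord0 => /esym/eqP.
by rewrite oner_eq0.
Qed.

(** [Q] is the joint weight of the source value and one fixed measurement outcome. If the normalised
    column is bounded by [kap], the extractor applies to it. Otherwise one entry exceeds [kap] times
    the total, the total is at most [w / kap], and it bounds each bias trivially. The right side
    adds both cases, so that it can be summed over outcomes. *)
Lemma column_bound (Q : X -> C) (w : C) : (forall x, 0 <= Q x) ->
  (forall x, Q x <= w) ->
  \sum_u `|\sum_x Q x * (-1) ^+ b x u| <= #|U|%:R * (2 * e * (\sum_x Q x) + kap^-1 * w).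
Proof.
move=> Q0 Qw; set q := \sum_x Q x.
have q0 : 0 <= q by apply: sumr_ge0.
have w0 : (#|U| > 0)%N -> 0 <= w \/ q = 0.
  move=> _; have [x _|X0] := pickP (@predT X); last by right; rewrite /q big_pred0.
  by left; apply: le_trans (Q0 x) (Qw x).
have norm_le u : `|\sum_x Q x * (-1) ^+ b x u| <= q.
  apply: le_trans (ler_norm_sum _ _ _) _; apply: ler_sum => x _.
  by rewrite normrM normrX normrN1 expr1n mulr1 ger0_norm.
have [U0|U0] := posnP #|U|.
  rewrite big_pred0 ?U0 ?mul0r // => u; have := card0_eq U0 u; by rewrite !inE.
have e0 := ltW e_gt0.
have kV0 : 0 <= kap^-1 by rewrite invr_ge0 ltW.
have [qz|qn0] := eqVneq q 0.
  have Qz x : Q x = 0.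
    by move/eqP: qz; rewrite psumr_eq0 // => /allP/(_ x (mem_index_enum _))/eqP.
  rewrite big1 => [|u _]; last by rewrite big1 ?normr0 // => x _; rewrite Qz mul0r.
  have [x _|X0] := pickP (@predT X).
    rewrite qz mulr0 add0r mulr_ge0 // mulr_ge0 // (le_trans (Q0 x)) //.
  by move: trR; rewrite big_pred0 // => /esym/eqP; rewrite oner_eq0.
have w1 : 0 <= w by case: (w0 U0) => // qz; rewrite qz eqxx in qn0.
have qp : 0 < q by rewrite lt_def qn0.
have [good|/forallPn[x bad]] := boolP [forall x, Q x <= kap * q].
  have := extractor (q := fun x => Q x / q).
  have -> : \sum_x Q x / q = 1 by rewrite -mulr_suml divff.
  move=> /(_ _ erefl) h.
  have {}h : \sum_u `|\sum_x Q x / q * (-1) ^+ b x u| <= 2 * e * #|U|%:R.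
    apply: h => x; first by rewrite divr_ge0.
    by rewrite ler_pdivrMr //; apply: (forallP good).
  have -> : \sum_u `|\sum_x Q x * (-1) ^+ b x u| =
      q * \sum_u `|\sum_x Q x / q * (-1) ^+ b x u|.
    rewrite mulr_sumr; apply: eq_bigr => u _.
    rewrite -[X in _ = X * _](ger0_norm q0) -normrM mulr_sumr; congr `|_|; apply: eq_bigr => x _.
    by rewrite mulrA mulrCA divff // mulr1.
  apply: le_trans (ler_wpM2l q0 h) _.
  rewrite mulrDr -[X in X <= _]addr0 lerD //; last by rewrite !mulr_ge0.
  by rewrite le_eqVlt; apply/orP; left; apply/eqP; ring.
have {}bad : kap * q < Q x.
  by rewrite real_ltNge // ger0_real // mulr_ge0 // ltW.
have qw : q <= kap^-1 * w.
  by rewrite -(ler_pM2l kap_gt0) mulrA divff ?gt_eqF // mul1r (le_trans (ltW bad)).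
apply: (@le_trans _ _ (\sum_(u in U) q)); first exact: ler_sum.
rewrite sumr_const -[q *+ _]mulr_natl; apply: ler_wpM2l => //.
by apply: le_trans qw _; rewrite lerDr !mulr_ge0.
Qed.

(** The average over seeds of the quadratic terms is at most [4 e] and that of the trace terms
    equals 2. With [c = 1 / sqrt e] this gives [4 sqrt e + 2 sqrt e] for twice the wanted
    quantity. *)
Lemma advice_bound :
  \sum_u \sum_x (-1) ^+ b x u * \tr (R x *m T u (G x)) <= 3 * sqrtC e * #|U|%:R.
Proof.
(* [d] is chosen so that the regularisation [d *+ n], summed over all [N] advice values, adds
   exactly 1 to the trace. *)
pose N : C := #|gT|%:R; pose d := (N * n%:R)^-1.
have N0 : 0 < N by rewrite ltr0n gT_gt0.
have n0 : 0 < n%:R :> C by rewrite ltr0n dim_gt0.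
have d0 : 0 < d by rewrite invr_gt0 mulr_gt0.
pose rho g := \sum_(x | G x == g) R x.
have prho g : psdmx (rho g) by apply: psd_sum.
have /fin_all_exists[W hW] g := pretty_good d0 (prho g).
have [A AE] : exists A, forall u g, A u g = \sum_(x | G x == g) (-1) ^+ b x u *: R x.
  by exists (fun u g => \sum_(x | G x == g) (-1) ^+ b x u *: R x).
have hA u g : hermmx (A u g).
  rewrite AE /hermmx trmxC_sum; apply: eq_bigr => x _.
  by rewrite trmxCZ rmorph_sign psd_herm.
pose F z := W (G z) *m R z *m W (G z).
have pF z : psdmx (F z) by have [hWg _ _] := hW (G z); apply: psd_hermcongr.
(* The weight of source value [x] together with pretty good guess [z]. Source and guess must share
   the same advice, since each advice value has its own measurement. *)
pose Q z x := if G x == G z then \tr (R x *m F z) else 0.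
have Q0 z x : 0 <= Q z x by rewrite /Q; case: ifP => // _; apply: psd_tr_mul.
have Qw z x : Q z x <= lam * \tr (sigma *m F z).
  have := psd_tr_mul (le_sigma x) (pF z).
  rewrite mulmxBl raddfB /= subr_ge0 -scalemxAl mxtraceZ /=; apply: le_trans.
  by rewrite /Q; case: ifP => // _; apply: psd_tr_mul.
have eQ z : \sum_x Q z x = \tr (rho (G z) *m F z).
  by rewrite -big_mkcond /= -raddf_sum -mulmx_suml.
(* Cyclicity turns [tr (rho_g W R_z W)] into [tr (W rho_g W R_z)], which is at most [tr R_z] because
   [W rho_g W <= 1]. *)
have sumQ : \sum_z \sum_x Q z x <= 1.
  rewrite -trR; apply: ler_sum => z _; rewrite eQ.
  have [hWg pW _] := hW (G z); have := psd_tr_mul pW (psdR z).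
  rewrite mulmxBl mul1mx raddfB /= subr_ge0; apply: le_trans.
  by rewrite /F -!mulmxA mxtrace_mulC -!mulmxA mxtrace_mulC -!mulmxA mxtrace_mulC !mulmxA
    mxtrace_mulC !mulmxA.
(* Here the advice is charged: each [g] has effects summing to at most 1, hence weight at most
   [tr sigma = 1]. *)
have sumF : \sum_z \tr (sigma *m F z) <= N.
  rewrite (partition_big G predT) //=.
  apply: (@le_trans _ _ (\sum_(g in gT) 1)); last by rewrite sumr_const.
  apply: ler_sum => g _.
  have -> : \sum_(z | G z == g) \tr (sigma *m F z) = \tr (sigma *m (W g *m rho g *m W g)).
    rewrite /rho mulmx_sumr mulmx_suml mulmx_sumr raddf_sum /=.
    by apply: eq_bigr => z /eqP <-.
  have [hWg pW _] := hW g; have := psd_tr_mul psd_sigma pW.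
  by rewrite mulmxBr mulmx1 raddfB /= tr_sigma subr_ge0.
(* Expanding both [A] gives the correlation of the signs of [b x u] and [b z u] under [Q]. Dropping
   the sign of [b z u] leaves the biases treated by [column_bound]. *)
have sumAW : \sum_u \sum_g \tr (A u g *m W g *m A u g *m W g) <= #|U|%:R * (4 * e).
  have -> : \sum_u \sum_g \tr (A u g *m W g *m A u g *m W g) =
     \sum_z \sum_u (-1) ^+ b z u * (\sum_x Q z x * (-1) ^+ b x u).
    have eu u : \sum_g \tr (A u g *m W g *m A u g *m W g) =
        \sum_z (-1) ^+ b z u * (\sum_x Q z x * (-1) ^+ b x u).
      rewrite (partition_big G predT) //=; apply: eq_bigr => g _.
      rewrite -mulmxA -mulmxA [X in _ *m (_ *m (X *m _))]AE mulmx_suml !mulmx_sumr raddf_sum /=.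
      apply: eq_bigr => z /eqP <-.
      rewrite -!scalemxAl -!scalemxAr mxtraceZ /=; congr (_ * _).
      rewrite AE mulmx_suml raddf_sum big_mkcond /=; apply: eq_bigr => x _.
      rewrite /Q; case: ifP => _; last by rewrite mul0r.
      by rewrite -scalemxAl mxtraceZ /= mulrC /F !mulmxA.
    by rewrite [RHS]exchange_big /=; apply: eq_bigr => u _; rewrite eu.
  apply: (@le_trans _ _ (\sum_z #|U|%:R * (2 * e * (\sum_x Q z x) +
     kap^-1 * (lam * \tr (sigma *m F z))))).
    apply: ler_sum => z _.
    apply: le_trans (column_bound (Q0 z) (Qw z)); apply: ler_sum => u _.
    have rS : \sum_x Q z x * (-1) ^+ b x u \is Num.real.
      apply: rpred_sum => x _; apply: rpredM; first exact: ger0_real.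
      by rewrite rpredX // rpredN rpred1.
    case: (b z u); rewrite ?expr1 ?expr0 ?mulN1r ?mul1r.
      by rewrite -normrN real_ler_norm // rpredN.
    exact: real_ler_norm.
  rewrite -mulr_sumr; apply: ler_wpM2l => //.
  rewrite big_split /= -!mulr_sumr.
  have -> : 4 * e = 2 * e * 1 + 2 * e by ring.
  have lam0 : 0 <= lam.
    have [x _|X0] := pickP (@predT X).
      have := psd_tr (psdD (le_sigma x) (psdR x)).
      by rewrite subrK mxtraceZ /= tr_sigma mulr1.
    by move: trR; rewrite big_pred0 // => /esym/eqP; rewrite oner_eq0.
  apply: lerD; first by apply: ler_wpM2l => //; rewrite mulr_ge0 // ltW.
  rewrite -(ler_pM2l kap_gt0) (mulrA kap kap^-1) divff ?gt_eqF // mul1r.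
  apply: le_trans (ler_wpM2l lam0 sumF) _; apply: le_trans lamG _.
  by rewrite mulrCA mulrA.
have eL : \sum_u \sum_x (-1) ^+ b x u * \tr (R x *m T u (G x)) =
   \sum_u \sum_g \tr (A u g *m T u g).
  apply: eq_bigr => u _; rewrite (partition_big G predT) //=; apply: eq_bigr => g _.
  rewrite AE mulmx_suml raddf_sum /=; apply: eq_bigr => x /eqP ->.
  by rewrite -scalemxAl mxtraceZ.
have s0 : 0 < sqrtC e by rewrite sqrtC_gt0.
have ss : e = sqrtC e * sqrtC e by rewrite -expr2 sqrtCK.
pose c := (sqrtC e)^-1; have c0 : 0 < c by rewrite invr_gt0.
rewrite eL -(ler_pM2l (_ : 0 < 2 :> C)) ?ltr0n // mulr_sumr.
apply: (@le_trans _ _ (\sum_u \sum_g (c * \tr (A u g *m W g *m A u g *m W g) +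
    c^-1 * (\tr (rho g) + d *+ n)))).
  apply: ler_sum => u _; rewrite mulr_sumr; apply: ler_sum => g _.
  by have [_ _ ->] := hW g.
under eq_bigr do rewrite big_split /=.
rewrite big_split /=.
have -> : \sum_(u : U) \sum_g c^-1 * (\tr (rho g) + d *+ n) = #|U|%:R * (c^-1 * 2).
  rewrite sumr_const mulr_natl; congr (_ *+ _); rewrite -mulr_sumr; congr (_ * _).
  rewrite big_split /= -raddf_sum sumr_const -mulrnA -[d *+ _]mulr_natr natrM.
  rewrite mulrC [_%:R * _]mulrC mulfV ?mulf_neq0 ?gt_eqF //.
  rewrite -[2]/(1 + 1); congr (_ + _).
  by rewrite -trR raddf_sum [RHS](partition_big G predT) //=; apply: eq_bigr => g _;
    rewrite raddf_sum.
have -> : \sum_u \sum_g c * \tr (A u g *m W g *m A u g *m W g) =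
    c * \sum_u \sum_g \tr (A u g *m W g *m A u g *m W g).
  by rewrite mulr_sumr; apply: eq_bigr => u _; rewrite mulr_sumr.
have -> : 2 * (3 * sqrtC e * #|U|%:R) = c * (#|U|%:R * (4 * e)) + #|U|%:R * (c^-1 * 2).
  by rewrite [in RHS]ss /c invrK; field; rewrite gt_eqF.
by apply: lerD => //; apply: ler_wpM2l => //; apply: ltW.
Qed.

End Advice.
End KonigTerhal.

(** * The hybrid argument *)

Section Hybrid.
Import Order.TTheory GRing.Theory Num.Theory.
Local Open Scope ring_scope.

Lemma Nat_pow_expn a b : Nat.pow a b = expn a b.
Proof. by elim: b => [|b IH]; rewrite ?expn0 // expnS -IH. Qed.

Lemma sum_ord_mul (V : nmodType) a b (F : nat -> V) :
  \sum_(k < a * b) F k = \sum_(p < a) \sum_(q < b) F (p * b + q)%N.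
Proof.
elim: a => [|a IH]; first by rewrite mul0n !big_ord0.
by rewrite mulSnr big_split_ord /= big_ord_recr /= -IH.
Qed.

Variable C : numClosedFieldType.

(** For independent uniform [y] and [u] the updated seed is again uniform: reindex the pairs by the
    involution [phi], which stores the overwritten bits in the second component. *)
Lemma resample (V : pzRingType) d t s (f : nat -> V) :
  NoDup s -> length s = t -> (forall a, List.In a s -> (a < d)%coq_nat) ->
  \sum_(y < Nat.pow 2 d) \sum_(u < Nat.pow 2 t) f (update d y s u) =
  (Nat.pow 2 t)%:R * \sum_(y < Nat.pow 2 d) f y.
Proof.
move=> nd <- sd; set t' := length s.
pose fy (y : 'I_(Nat.pow 2 d)) (u : 'I_(Nat.pow 2 t')) : 'I_(Nat.pow 2 d) :=
  Ordinal (introT ssrnat.ltP (update_lt d y s u)).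
pose fu (y : 'I_(Nat.pow 2 d)) : 'I_(Nat.pow 2 t') :=
  Ordinal (introT ssrnat.ltP (restrict_lt y s)).
pose phi (p : 'I_(Nat.pow 2 d) * 'I_(Nat.pow 2 t')) := (fy p.1 p.2, fu p.1).
have phiK : cancel phi phi.
  move=> [y u]; congr pair; apply: val_inj => /=.
    by rewrite update_restrict //; apply/ssrnat.ltP.
  by rewrite restrict_update //; apply/ssrnat.ltP.
rewrite pair_bigA /= (reindex_inj (can_inj phiK)) /=.
rewrite (eq_bigr (fun p : 'I_(Nat.pow 2 d) * 'I_(Nat.pow 2 t') => f p.1)) => [|[y u] _] /=.
  rewrite -(pair_bigA _ (fun (y : 'I_(Nat.pow 2 d)) (_ : 'I_(Nat.pow 2 t')) => f y)) /= mulr_sumr; apply: eq_bigr => y _.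
  by rewrite sumr_const card_ord mulr_natl.
by rewrite update_restrict //; apply/ssrnat.ltP.
Qed.

Lemma half_pow_mul i : (2^-1 : C) ^+ i * (Nat.pow 2 i)%:R = 1.
Proof. by rewrite Nat_pow_expn natrX -exprMn mulVf ?pnatr_eq0 // expr1n. Qed.

(** Writing [z = p 2^i + q] with [q < 2^i], the prefix fixes [q = w] and leaves [2^(m - i)] choices
    of [p]. *)
Lemma prefix_avg m i w : (i <= m)%N -> (w < Nat.pow 2 i)%N ->
  (2^-1 : C) ^+ (m - i) * \sum_(z < Nat.pow 2 m | Nat.modulo z (Nat.pow 2 i) == w) 1 = 1.
Proof.
move=> im wi; rewrite big_mkcond /=.
have -> : Nat.pow 2 m = (Nat.pow 2 (m - i) * Nat.pow 2 i)%N.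
  by rewrite !Nat_pow_expn -expnD subnK.
rewrite (sum_ord_mul _ _ (fun z => if Nat.modulo z (Nat.pow 2 i) == w then 1 else 0)).
rewrite (eq_bigr (fun=> 1)) => [|p _]; last first.
  rewrite (bigD1 (Ordinal wi)) //= mul_add_mod; last exact/ssrnat.ltP.
  rewrite eqxx big1 ?addr0 // => q qw; rewrite mul_add_mod; last exact/ssrnat.ltP.
  by rewrite -[w]/(val (Ordinal wi)) (inj_eq val_inj) (negbTE qw).
by rewrite sumr_const card_ord half_pow_mul.
Qed.

Variables (n t d m D : nat) (Cf : nat -> nat -> bool) (S : nat -> list nat).
Variables (R : 'I_(Nat.pow 2 n) -> 'M[C]_D) (sigma : 'M[C]_D) (lam kap e : C).
Variable T : nat -> nat -> 'M[C]_D.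
Hypothesis psdR : forall x, psdmx (R x).
Hypothesis trR : \sum_x \tr (R x) = 1.
Hypothesis tr_sigma : \tr sigma = 1.
Hypothesis psd_sigma : psdmx sigma.
Hypothesis le_sigma : forall x, psdmx (lam *: sigma - R x).
Hypothesis contrT : forall z y, contraction (T z y).
Hypothesis kap_gt0 : 0 < kap.
Hypothesis e_gt0 : 0 < e.
Hypothesis extractor : forall q : 'I_(Nat.pow 2 n) -> C,
  (forall x, 0 <= q x) -> \sum_x q x = 1 -> (forall x, q x <= kap) ->
  \sum_(u < Nat.pow 2 t) `|\sum_x q x * (-1) ^+ Cf x u| <= 2 * e * (Nat.pow 2 t)%:R.
Hypothesis design : forall i, (i < m)%N ->
  [/\ NoDup (S i), length (S i) = t & forall a, List.In a (S i) -> (a < d)%coq_nat].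
Hypothesis lam_design : forall i, (i < m)%N ->
  lam * (2 ^ \sum_(j < i) 2 ^ inter_size (S j) (S i))%:R <= 2 * kap * e.

Let Ext x y := trevisan Cf S m x y.
Let prefix i z := Nat.modulo z (Nat.pow 2 i).
(* The weight of [z] when the first [i] output bits come from the extractor and the others are uniform. *)
Let hyb i x y z : C := if prefix i z == prefix i (Ext x y) then 2^-1 ^+ (m - i) else 0.
(** The test operator left for bit [i]: the bits above [i] are averaged out, and bit [i] enters as a
    sign. It sees the source only through the prefix [w]. *)
Let Tbar i y w : 'M[C]_D :=
  2^-1 ^+ (m - i) *: \sum_(z < Nat.pow 2 m | prefix i z == w) (-1) ^+ Nat.testbit z i *: T z y.

Lemma contraction_Tbar i y w : (i <= m)%N -> (w < Nat.pow 2 i)%N -> contraction (Tbar i y w).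
Proof.
move=> im wi; apply: contraction_avg.
- move=> z _; case: Nat.testbit; rewrite ?scaleN1r ?scale1r //.
  exact: contraction_opp.
- by rewrite exprn_ge0 // invr_ge0 ler0n.
- exact: prefix_avg.
Qed.

(** When the prefixes agree, fixing bit [i] doubles the weight if the bit is right and kills it if
    it is wrong. The change is therefore plus or minus the old weight. *)
Lemma hyb_step i x y z : (i < m)%N ->
  hyb i.+1 x y z - hyb i x y z =
  hyb i x y z * (-1) ^+ Cf x (restrict y (S i)) * (-1) ^+ Nat.testbit z i.
Proof.
move=> im; rewrite /hyb -mulrA -signr_addb.
have mi : (m - i = (m - i.+1).+1)%N by rewrite subnSK.
have -> : (prefix i.+1 z == prefix i.+1 (Ext x y)) =
    (prefix i z == prefix i (Ext x y)) && (Nat.testbit z i == Cf x (restrict y (S i))).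
  have tE : Nat.testbit (Ext x y) i = Cf x (restrict y (S i)).
    by apply: testbit_trevisan; apply/ssrnat.ltP.
  have := mod_pow2S_eq z (Ext x y) i; rewrite tE => h.
  apply/eqP/andP => [/h[e1 e2]|[/eqP e1 /eqP e2]]; first by split; apply/eqP.
  by apply/h.
case: eqP => _ /=; last by rewrite mul0r subrr.
rewrite mi exprS.
by case: Nat.testbit; case: (Cf _ _) => /=; rewrite ?expr0 ?expr1; field.
Qed.

Lemma hybrid_bound i : (i < m)%N ->
  \sum_(x < Nat.pow 2 n) \sum_(y < Nat.pow 2 d) \sum_(z < Nat.pow 2 m)
     (hyb i.+1 x y z - hyb i x y z) * \tr (R x *m T z y) <=
  3 * sqrtC e * (Nat.pow 2 d)%:R.
Proof.
move=> im; have [nd St Sd] := design im.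
pose Z y x := Tbar i y (prefix i (Ext x y)).
pose f y := \sum_(x < Nat.pow 2 n) (-1) ^+ Cf x (restrict y (S i)) * \tr (R x *m Z y x).
have -> : \sum_(x < Nat.pow 2 n) \sum_(y < Nat.pow 2 d) \sum_(z < Nat.pow 2 m)
     (hyb i.+1 x y z - hyb i x y z) * \tr (R x *m T z y) = \sum_(y < Nat.pow 2 d) f y.
  rewrite exchange_big /=; apply: eq_bigr => y _; apply: eq_bigr => x _.
  rewrite /Z /Tbar -scalemxAr mxtraceZ mulmx_sumr raddf_sum /= !mulr_sumr.
  rewrite [RHS]big_mkcond /=; apply: eq_bigr => z _.
  rewrite hyb_step // /hyb; case: eqP => _; last by rewrite !mul0r.
  by rewrite -scalemxAr mxtraceZ; ring.
have t0 : 0 < (Nat.pow 2 t)%:R :> C by rewrite Nat_pow_expn ltr0n expn_gt0.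
(* The seed is replaced by [y] with its bits in [S i] overwritten by an independent [u]. It then
   suffices to bound the sum over [u] for each frozen [y]. *)
rewrite -(ler_pM2l t0) -(resample f nd St Sd).
apply: (@le_trans _ _ (\sum_(y < Nat.pow 2 d) 3 * sqrtC e * (Nat.pow 2 t)%:R)); last first.
  rewrite sumr_const card_ord -[X in X <= _]mulr_natr.
  by rewrite le_eqVlt; apply/orP; left; apply/eqP; ring.
apply: ler_sum => y _.
(* The advice tabulates, for each j < i, the j-th output bit as a function of the seed bits in S_j and S_i. *)
pose aT := {j : 'I_i & 'I_(Nat.pow 2 (length (inter (S j) (S i))))}.
pose gT := {ffun aT -> bool}.
pose G (x : 'I_(Nat.pow 2 n)) : gT := [ffun jw : aT =>
  Cf x (restrict (update d y (inter (S (tag jw)) (S i)) (tagged jw)) (S (tag jw)))].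
have cG : #|{: gT}| = (2 ^ \sum_(j < i) 2 ^ inter_size (S j) (S i))%N.
  rewrite card_ffun card_bool card_tagged sumnE big_map big_enum /=; congr (2 ^ _)%N.
  by apply: eq_bigr => j _; rewrite card_ord Nat_pow_expn.
(* For fixed [u], every earlier output bit is an entry of the advice table, looked up at the bits of
   the seed in the intersection. *)
have ZG u x x' : G x = G x' -> Z (update d y (S i) u) x = Z (update d y (S i) u) x'.
  move=> eG; rewrite /Z; congr (Tbar _ _ _); apply/mod_pow2_eq => j ji.
  have jm : (j < m)%N by apply: ltn_trans im; apply/ssrnat.ltP.
  rewrite /Ext !testbit_trevisan; try exact/ssrnat.ltP.
  have [_ _ Sjd] := design jm; rewrite !(restrict_update_inter d y (S j) (S i) u Sjd).
  set w := restrict _ (inter _ _).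
  have wlt : (w < Nat.pow 2 (length (inter (S j) (S i))))%N by apply/ssrnat.ltP/restrict_lt.
  pose jo := Ordinal (introT ssrnat.ltP ji).
  have := congr1 (fun g : gT => g (Tagged (fun j : 'I_i => 'I_(Nat.pow 2 (length (inter (S j) (S i)))))
     (Ordinal wlt : 'I_(Nat.pow 2 (length (inter (S jo) (S i))))))) eG.
  by rewrite !ffunE.
(* Factor [Z] through the advice: any representative [x] serves by [ZG], and an advice value that
   never occurs gets the contraction 0. *)
pose T' (u : 'I_(Nat.pow 2 t)) (g : gT) :=
  if [pick x | G x == g] is Some x then Z (update d y (S i) u) x else 0.
have T'G u x : T' u (G x) = Z (update d y (S i) u) x.
  rewrite /T'; case: pickP => [x' /eqP/(ZG u) //|/(_ x)]; by rewrite eqxx.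
have cT' u g : contraction (T' u g).
  rewrite /T'; case: pickP => [x _|_]; last exact: contraction0.
  apply: contraction_Tbar; first exact: ltnW.
  by apply/ssrnat.ltP/Nat.mod_upper_bound; rewrite Nat_pow_expn; apply/eqP; rewrite expn_eq0.
have := advice_bound (b := fun (x : 'I_(Nat.pow 2 n)) (u : 'I_(Nat.pow 2 t)) => Cf x u) G psdR trR tr_sigma
  psd_sigma le_sigma cT' kap_gt0 e_gt0.
rewrite card_ord cG => h; apply: le_trans (h extractor (lam_design im)).
rewrite le_eqVlt; apply/orP; left; apply/eqP; apply: eq_bigr => u _.
apply: eq_bigr => x _; rewrite T'G restrict_update //.
by rewrite St; apply/ssrnat.ltP.
Qed.

(** Telescoping over the hybrids. At [i = m] the weight is the indicator of the true output, and at
    [i = 0] the empty prefix always matches and the weight is [2^-m]. *)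
Lemma trevisan_bound :
  \sum_(x < Nat.pow 2 n) \sum_(y < Nat.pow 2 d) \sum_(z < Nat.pow 2 m)
     ((z == trevisan Cf S m x y :> nat)%:R - 2^-1 ^+ m) * \tr (R x *m T z y) <=
  m%:R * (3 * sqrtC e * (Nat.pow 2 d)%:R).
Proof.
pose H i := \sum_(x < Nat.pow 2 n) \sum_(y < Nat.pow 2 d) \sum_(z < Nat.pow 2 m)
     hyb i x y z * \tr (R x *m T z y).
have HB i j : \sum_(x < Nat.pow 2 n) \sum_(y < Nat.pow 2 d) \sum_(z < Nat.pow 2 m)
     (hyb i x y z - hyb j x y z) * \tr (R x *m T z y) = H i - H j.
  rewrite /H -sumrB; apply: eq_bigr => x _; rewrite -sumrB; apply: eq_bigr => y _.
  by rewrite -sumrB; apply: eq_bigr => z _; rewrite mulrBl.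
have -> : \sum_(x < Nat.pow 2 n) \sum_(y < Nat.pow 2 d) \sum_(z < Nat.pow 2 m)
     ((z == trevisan Cf S m x y :> nat)%:R - 2^-1 ^+ m) * \tr (R x *m T z y) = H m - H 0%N.
  rewrite -HB; apply: eq_bigr => x _; apply: eq_bigr => y _; apply: eq_bigr => z _.
  congr ((_ - _) * _).
    rewrite /hyb subnn expr0 /prefix !Nat.mod_small; try exact: trevisan_lt; try exact/ssrnat.ltP.
    by case: eqP.
  by rewrite /hyb /prefix (_ : Nat.pow 2 0 = 1%N) // !Nat.mod_1_r eqxx subn0.
rewrite -(telescope_sumr _ (leq0n m)) big_mkord.
apply: (@le_trans _ _ (\sum_(i < m) 3 * sqrtC e * (Nat.pow 2 d)%:R)).
  by apply: ler_sum => i _; rewrite -HB; apply: hybrid_bound.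
by rewrite sumr_const card_ord [X in _ <= X]mulr_natl.
Qed.

End Hybrid.

(** * Matrices over pairs of reals as MathComp matrices *)

From mathcomp Require Import complex Rstruct.

Section Bridge.
Import Order.TTheory GRing.Theory Num.Theory.
Local Open Scope ring_scope.
Local Open Scope sesquilinear_scope.
Local Notation K := (complex R).
Local Notation "r %:K" := (real_complex R r) (at level 2, format "r %:K").

Definition toK (a : Cx) : K := Complex (Defs.Re a) (Defs.Im a).
Definition ofK (z : K) : Cx := mkCx (complex.Re z) (complex.Im z).

Lemma ofK_K z : toK (ofK z) = z. Proof. by case: z. Qed.
Lemma toK_inj : injective toK.
Proof. by move=> [a b] [c d] [-> ->]. Qed.
Lemma toKD a b : toK (Cadd a b) = toK a + toK b. Proof. by []. Qed.
Lemma toKM a b : toK (Cmul a b) = toK a * toK b. Proof. by []. Qed.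
Lemma toKN a : toK (Copp a) = - toK a. Proof. by []. Qed.
Lemma toK_conj a : toK (Cconj a) = (toK a)^*. Proof. by []. Qed.
Lemma toKR r : toK (RtoC r) = r%:K. Proof. by []. Qed.

Lemma toK_ge0 a : 0 <= toK a <-> Defs.Im a = 0%R /\ Rle 0 (Defs.Re a).
Proof.
rewrite lecE /=; split => [/andP[/eqP h /RleP h']|[-> /RleP h]]; first by split.
by rewrite eqxx.
Qed.

Lemma toK_sum N f : toK (Csum N f) = \sum_(i < N) toK (f i).
Proof. by elim: N => [|N IH]; rewrite ?big_ord0 // big_ord_recr /= toKD IH. Qed.

Lemma Rsumn_sum N (f : nat -> R) : Rsumn N f = \sum_(i < N) f i.
Proof. by elim: N => [|N IH]; rewrite ?big_ord0 // big_ord_recr /= IH. Qed.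

Definition toM N (A : Mat) : 'M[K]_N := \matrix_(i < N, j < N) toK (A i j).
Definition ofM N (B : 'M[K]_N) : Mat := fun i j =>
  match insub i, insub j with Some i', Some j' => ofK (B i' j') | _, _ => C0 end.

Lemma ofM_K N (B : 'M[K]_N) : toM N (ofM B) = B.
Proof. by apply/matrixP => i j; rewrite !mxE /ofM !valK ofK_K. Qed.

Lemma toM_mul N A B : toM N (mmul N A B) = toM N A *m toM N B.
Proof.
apply/matrixP => i j; rewrite !mxE toK_sum; apply: eq_bigr => l _.
by rewrite toKM !mxE.
Qed.

Lemma toM_adj N A : toM N (adj A) = (toM N A) ^t*.
Proof. by apply/matrixP => i j; rewrite !mxE toK_conj. Qed.

Lemma toM_tr N A : toK (mtrace N A) = \tr (toM N A).
Proof. by rewrite toK_sum; apply: eq_bigr => i _; rewrite !mxE. Qed.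

Lemma toM_sub N A B : toM N (msub A B) = toM N A - toM N B.
Proof. by apply/matrixP => i j; rewrite !mxE toKD toKN. Qed.

Lemma toM_scale N r A : toM N (mscale r A) = r%:K *: toM N A.
Proof. by apply/matrixP => i j; rewrite !mxE toKM toKR. Qed.

Lemma toK_Msum k f i j : toK (Msum k f i j) = \sum_(x < k) toK (f x i j).
Proof. by elim: k => [|k IH]; rewrite ?big_ord0 // big_ord_recr /= /madd toKD IH. Qed.

Lemma toM_Msum N k f : toM N (Msum k f) = \sum_(x < k) toM N (f x).
Proof.
apply/matrixP => i j; rewrite mxE toK_Msum summxE; apply: eq_bigr => x _.
by rewrite mxE.
Qed.

(** [psd] tests column vectors and [psdmx] row vectors, so the test vector has to be conjugated in
    passing from one to the other. *)
Lemma psd_toM N A : psd N A <-> psdmx (toM N A).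
Proof.
have e (w : nat -> Cx) (v : 'rV[K]_N) : (forall i : 'I_N, v 0 i = (toK (w i))^*) ->
  toK (Csum N (fun i => Cmul (Cconj (w i)) (Csum N (fun j => Cmul (A i j) (w j))))) =
  (v *m toM N A *m v ^t*) 0 0.
  move=> hv; rewrite toK_sum -mulmxA mxE; apply: eq_bigr => i _.
  rewrite toKM toK_conj hv; congr (_ * _); rewrite mxE toK_sum; apply: eq_bigr => j _.
  by rewrite toKM !mxE hv conjCK.
split=> pA v.
  pose w i : Cx := if insub i is Some i' then ofK (v 0 i')^* else C0.
  rewrite -(e w); first by apply/toK_ge0; apply: pA.
  by move=> i; rewrite /w valK ofK_K conjCK.
apply/toK_ge0; rewrite (e v (\row_i (toK (v i))^*)); first exact: pA.
by move=> i; rewrite mxE.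
Qed.

Lemma density_toM N A : density N A -> psdmx (toM N A) /\ \tr (toM N A) = 1.
Proof. by case=> /psd_toM pA tA; split; rewrite // -toM_tr tA. Qed.

(** [msqrt] is an [epsilon] choice. Existence of a root gives its specification, and uniqueness of
    the positive root identifies it with [B] on indices below [N]. *)
Lemma trnorm_root N A (B : 'M[K]_N) :
  psdmx B -> B *m B = (toM N A) ^t* *m toM N A -> \tr B = (trnorm N A)%:K.
Proof.
move=> pB BB; rewrite /trnorm /msqrt.
set P := fun _ : Mat => _.
have ex : exists M, P M.
  exists (ofM B); split; first by apply/psd_toM; rewrite ofM_K.
  move=> i j /ssrnat.ltP iN /ssrnat.ltP jN; apply: toK_inj.
  have := congr1 (fun X : 'M_N => X (Ordinal iN) (Ordinal jN)) BB.
  by rewrite -toM_adj -toM_mul -{1 2}(ofM_K B) -toM_mul !mxE.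
have := epsilon_spec (inhabits mzero) P ex; set M := epsilon _ _ => -[/psd_toM pM MM].
have -> : B = toM N M.
  apply: psd_sqrt_uniq => //; rewrite BB -toM_adj -!toM_mul.
  by apply/matrixP => i j; rewrite !mxE MM //; apply/ssrnat.ltP.
rewrite -toM_tr; have : 0 <= toK (mtrace N M) by rewrite toM_tr; apply: psd_tr.
by move=> /toK_ge0[]; rewrite /toK => ->.
Qed.

Lemma trnorm_herm N A : hermmx (toM N A) ->
  exists2 T : 'M[K]_N, contraction T & (trnorm N A)%:K = \tr (toM N A *m T).
Proof.
move=> hA; have [B [T [pB BB cT tB]]] := herm_abs hA.
by exists T => //; rewrite -tB (trnorm_root (A := A) pB) // hA.
Qed.

Lemma trnorm_diag N A (D : 'rV[K]_N) : toM N A = diag_mx D -> (forall i, D 0 i \is Num.real) ->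
  (trnorm N A)%:K = \sum_i `|D 0 i|.
Proof.
move=> eA rD; pose B := diag_mx (\row_i `|D 0 i|).
rewrite -(trnorm_root (B := B)).
- by rewrite mxtrace_diag; apply: eq_bigr => i _; rewrite mxE.
- by apply: psd_diag_mx => i; rewrite mxE.
- rewrite eA (diag_mx_trmxC rD) !mulmx_diag; congr diag_mx; apply/rowP => i.
  by rewrite !mxE -expr2 real_normK // expr2.
Qed.

Lemma real_IZR2 : IZR 2 = 2%:R :> R. Proof. by []. Qed.

Lemma real_inv_pow d : (Rinv (pow 2 d))%:K = (2^-1) ^+ d.
Proof. by rewrite RpowE RinvE real_IZR2 fmorphV rmorphXn rmorph_nat exprVn. Qed.

(** * Tensor products with a classical register as block matrices *)

Section Blocks.
Variable D : nat.
Hypothesis D0 : (0 < D)%N.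

(** The coisometry that selects block [a]; its adjoint embeds the [D]-dimensional space there, so
    conjugation places a matrix in a diagonal block. *)
Definition block_mx_at N a : 'M[K]_(D, N) := \matrix_(e, i) (i == a * D + e :> nat)%N%:R.
Local Notation V := block_mx_at.

Lemma mul_add_eq a b (e e' : 'I_D) : ((a * D + e == b * D + e')%N) = (a == b) && (e == e').
Proof.
apply/eqP/andP => [h|[/eqP -> /eqP -> //]].
have eD (x : 'I_D) : (x < D)%coq_nat by apply/ssrnat.ltP.
have dv c (x : 'I_D) : Nat.div (c * D + x)%N D = c by apply: mul_add_div.
have md c (x : 'I_D) : Nat.modulo (c * D + x)%N D = x by apply: mul_add_mod.
have := dv a e; have := md a e; rewrite h dv md => e2 e1.
by split; apply/eqP => //; apply: val_inj.
Qed.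

Lemma block_lt N a (e : 'I_D) : (a.+1 * D <= N)%N -> (a * D + e < N)%N.
Proof. by apply: leq_trans; rewrite mulSnr ltn_add2l. Qed.

Lemma block_ortho N a b : (a.+1 * D <= N)%N -> V N a *m (V N b) ^t* = (a == b)%:R%:M.
Proof.
move=> aN; apply/matrixP => e e'; rewrite !mxE.
rewrite (bigD1 (Ordinal (block_lt e aN))) //= big1 => [|i ne].
  by rewrite !mxE eqxx mul1r addr0 rmorph_nat /= mul_add_eq; case: eqP; case: eqP.
rewrite !mxE; case: eqP => [h|]; last by rewrite mul0r.
by case/eqP: ne; apply: val_inj.
Qed.

Lemma toM_block N a M : toM N (kron D (proj a) M) = (V N a) ^t* *m toM D M *m V N a.
Proof.
apply/matrixP => i j.
have md (k : nat) : (Nat.modulo k D < D)%N.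
  by apply/ssrnat.ltP/Nat.mod_upper_bound/eqP; rewrite -lt0n.
pose r (k : nat) : 'I_D := Ordinal (md k).
have VE (e : 'I_D) (k : 'I_N) : V N a e k = ((Nat.div k D == a) && (e == r k))%:R.
  rewrite mxE; congr (nat_of_bool _)%:R.
  have kE : nat_of_ord k = (Nat.div k D * D + r k)%N by rewrite mulnC; apply: Nat.div_mod_eq.
  by rewrite [X in X == _]kE mul_add_eq [r k == e]eq_sym.
have inner : ((V N a) ^t* *m toM D M) i (r j) =
    (Nat.div i D == a)%:R * toK (M (Nat.modulo i D) (Nat.modulo j D)).
  rewrite mxE (bigD1 (r i)) //= big1 => [|e ne]; last first.
    by rewrite mxE mxE VE (negbTE ne) andbF rmorph_nat mul0r.
  by rewrite mxE mxE VE eqxx andbT rmorph_nat addr0 mxE.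
rewrite [RHS]mxE (bigD1 (r j)) //= big1 => [|e ne]; last by rewrite VE (negbTE ne) andbF mulr0.
rewrite VE eqxx andbT addr0 inner mulrAC -natrM mulnb mxE /kron toKM; congr (_ * _).
rewrite /proj -[Nat.eqb (Nat.div i D) a]/(_ == _) -[Nat.eqb (Nat.div j D) a]/(_ == _).
by case: ifP.
Qed.

Lemma proj_sum N i j : (i < N)%N -> toK (mid i j) = \sum_(a < N) toK (proj a i j).
Proof.
move=> iN; rewrite /mid /proj (bigD1 (Ordinal iN)) //= big1 => [|a ne].
  by rewrite Nat.eqb_refl addr0 /= Nat.eqb_sym.
by case: Nat.eqb_spec => // h; case/eqP: ne; apply: val_inj.
Qed.

Lemma div_lt NA (i : 'I_(NA * D)) : (Nat.div i D < NA)%N.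
Proof.
apply/ssrnat.ltP; apply: Nat.Div0.div_lt_upper_bound.
by rewrite Nat.mul_comm; apply/ssrnat.ltP/(ltn_ord i).
Qed.

Lemma toM_kron_mid NA M : toM (NA * D) (kron D mid M) =
  \sum_(a < NA) (V (NA * D) a) ^t* *m toM D M *m V (NA * D) a.
Proof.
under [RHS]eq_bigr do rewrite -toM_block.
apply/matrixP => i j; rewrite mxE summxE /kron toKM (proj_sum _ (div_lt i)) mulr_suml.
by apply: eq_bigr => a _; rewrite mxE.
Qed.

Lemma block_le NA (a : 'I_NA) : (a.+1 * D <= NA * D)%N.
Proof. by rewrite leq_mul2r ltn_ord orbT. Qed.

Lemma block_compress NA (F : nat -> 'M[K]_D) (x : 'I_NA) :
  let W := V (NA * D) in
  W x *m (\sum_(a < NA) (W a) ^t* *m F a *m W a) *m (W x) ^t* = F x.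
Proof.
move=> W; rewrite mulmx_sumr mulmx_suml (bigD1 x) //= big1 => [|a ax].
  rewrite addr0 !mulmxA block_ortho ?block_le // eqxx mul1mx -mulmxA.
  by rewrite block_ortho ?block_le // eqxx mulmx1.
rewrite !mulmxA block_ortho ?block_le //.
have -> : (x == a :> nat) = false by apply/negbTE; rewrite eq_sym.
by rewrite -scalemx1 scale0r !mul0mx.
Qed.

End Blocks.

Lemma toK_proj a i j : toK (proj a i j) = ((i == a) && (j == a))%:R.
Proof.
by rewrite /proj -[Nat.eqb i a]/(i == a) -[Nat.eqb j a]/(j == a); case: ifP.
Qed.

Lemma toK_mid i j : toK (mid i j) = (i == j)%:R.
Proof. by rewrite /mid -[Nat.eqb i j]/(i == j); case: ifP. Qed.

Lemma div_modE Q (i j : nat) :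
  (i == j) = (Nat.div i Q == Nat.div j Q) && (Nat.modulo i Q == Nat.modulo j Q).
Proof.
apply/eqP/andP => [-> //|[/eqP e1 /eqP e2]].
by rewrite (Nat.div_mod_eq i Q) e1 e2 -Nat.div_mod_eq.
Qed.

Lemma kron_proj Q z y i j : (y < Q)%N -> kron Q (proj z) (proj y) i j = proj (z * Q + y)%N i j.
Proof.
move=> /ssrnat.ltP yQ; apply: toK_inj; rewrite /kron toKM !toK_proj -natrM mulnb.
rewrite (div_modE Q i) (div_modE Q j).
have -> : Nat.div (z * Q + y)%N Q = z by apply: mul_add_div.
have -> : Nat.modulo (z * Q + y)%N Q = y by apply: mul_add_mod.
by rewrite andbACA.
Qed.

Lemma toK_kron_mid Q a b i j :
  toK (kron Q (mscale a mid) (mscale b mid) i j) = (a * b)%:K * (i == j)%:R.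
Proof.
rewrite /kron /mscale !toKM !toKR !toK_mid (div_modE Q i j) -mulnb natrM rmorphM /=.
by ring.
Qed.

Lemma ge0_K (z : K) : 0 <= z -> (complex.Re z)%:K = z.
Proof. by case: z => a b; rewrite lecE /= => /andP[/eqP -> _]. Qed.

(** The difference of the real and ideal classical states is diagonal. For each seed its two entries
    are plus and minus [2^-t] times half the bias, so its trace norm is the mean absolute bias. *)
Lemma strong_ext_sum n t (Cf : nat -> nat -> bool) k eps :
  strong_ext n t 1 (fun x y => Nat.b2n (Cf x y)) k eps ->
  forall q : 'I_(Nat.pow 2 n) -> K, (forall x, 0 <= q x) -> \sum_x q x = 1 ->
  (forall x, q x <= (Rpower 2 (- k))%:K) ->
  \sum_(u < Nat.pow 2 t) `|\sum_x q x * (-1) ^+ Cf x u| <= 2 * eps%:K * (Nat.pow 2 t)%:R.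
Proof.
move=> ext q q0 q1 qk; set Q := Nat.pow 2 t.
pose p i := if insub i is Some x then complex.Re (q x) else 0.
have pq (x : 'I_(Nat.pow 2 n)) : (p x)%:K = q x by rewrite /p valK ge0_K.
have pd : prob_dist (Nat.pow 2 n) p.
  split.
    move=> x /ssrnat.ltP xn; apply/RleP.
    by rewrite -(lecR 0) (pq (Ordinal xn)).
  apply: (@complexI R); rewrite Rsumn_sum rmorph_sum /=.
  by under eq_bigr do rewrite pq.
have pk : Rle k (Hmin_cl (Nat.pow 2 n) p).
  apply: Hmin_cl_ge => // x /ssrnat.ltP xn; apply/RleP.
  by rewrite -lecR (pq (Ordinal xn)).
have {pd pk} := ext p pd pk; rewrite -/Q.
set A := msub _ _ => /RleP ext_le.
(* The diagonal entry at output bit [z] and seed [y]. The constant subtracted is the uniform weight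
   of the pair. *)
pose dd z y : K := \sum_x q x * (2^-1) ^+ t * (z == Nat.b2n (Cf x y))%:R - 2^-1 * 2^-1 ^+ t.
have rdd z y : dd z y \is Num.real.
  apply: rpredB; last by rewrite rpredM ?rpredX // rpredV realn.
  apply: rpred_sum => x _; rewrite !rpredM ?realn ?rpredX ?rpredV ?realn //.
  exact: ger0_real.
have Q0 : (0 < Q)%N by rewrite /Q Nat_pow_expn expn_gt0.
have eA : toM (Nat.pow 2 1 * Q) A = diag_mx (\row_i dd (Nat.div i Q) (Nat.modulo i Q)).
  apply/matrixP => i j; rewrite !mxE /A /msub toKD toKN.
  rewrite /ideal_cl toK_kron_mid /ext_out_cl toK_Msum.
  have -> : (Rmult (Rinv (pow 2 1)) (Rinv (pow 2 t)))%:K = 2^-1 * 2^-1 ^+ t.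
    by rewrite -[X in _ = X * _]expr1 -!real_inv_pow; apply: rmorphM.
  have -> : \sum_(x < Nat.pow 2 n) toK (Msum Q (fun y => mscale (Rmult (p x) (Rinv (pow 2 t)))
       (kron Q (proj (Nat.b2n (Cf x y))) (proj y))) i j) =
     \sum_(x < Nat.pow 2 n) q x * 2^-1 ^+ t *
       (Nat.div i Q == Nat.b2n (Cf x (Nat.modulo i Q)))%:R * (i == j :> nat)%:R.
    apply: eq_bigr => x _; rewrite toK_Msum.
    have md : (Nat.modulo i Q < Q)%N.
      by apply/ssrnat.ltP/Nat.mod_upper_bound/eqP; rewrite -lt0n.
    have E y : toK (mscale (Rmult (p x) (Rinv (pow 2 t)))
       (kron Q (proj (Nat.b2n (Cf x y))) (proj y)) i j) = q x * 2^-1 ^+ t *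
       (((Nat.div i Q == Nat.b2n (Cf x y)) && (Nat.div j Q == Nat.b2n (Cf x y)))%:R *
        ((Nat.modulo i Q == y) && (Nat.modulo j Q == y))%:R).
      by rewrite /mscale toKM toKR rmorphM /= pq real_inv_pow /kron toKM !toK_proj.
    rewrite (bigD1 (Ordinal md)) //= big1 => [|y ne]; last first.
      rewrite E; have -> : (Nat.modulo i Q == y) = false.
        by apply/negbTE; apply: contra ne => /eqP h; apply/eqP/val_inj.
      by rewrite !mulr0.
    rewrite addr0 E eqxx /= -!mulrA -!natrM !mulnb (div_modE Q i j).
    congr (_ * (_ * (nat_of_bool _)%:R)); rewrite [Nat.modulo j Q == _]eq_sym.
        by case: (Nat.div i Q =P Nat.b2n _) => //= <-; rewrite [in LHS]eq_sym.
  rewrite -mulr_suml -mulrBl /dd -val_eqE /=; case: eqP => _; by rewrite ?mulr1 ?mulr0.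
have tA := trnorm_diag eA.
have {}tA : (trnorm (Nat.pow 2 1 * Q) A)%:K = 2^-1 ^+ t *
    \sum_(u < Q) `|\sum_x q x * (-1) ^+ Cf x u|.
  rewrite tA => [|i]; last by rewrite mxE.
  rewrite (eq_bigr (fun i : 'I_(Nat.pow 2 1 * Q) => `|dd (Nat.div i Q) (Nat.modulo i Q)|)) => [|i _]; last first.
    by rewrite mxE.
  rewrite (sum_ord_mul (Nat.pow 2 1) Q (fun i => `|dd (Nat.div i Q) (Nat.modulo i Q)|)).
  have E (z : nat) : \sum_(y < Q) `|dd (Nat.div (z * Q + y)%N Q) (Nat.modulo (z * Q + y)%N Q)|
     = \sum_(y < Q) `|dd z y|.
    apply: eq_bigr => y _; have yQ : (y < Q)%coq_nat by apply/ssrnat.ltP.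
    have -> : Nat.div (z * Q + y)%N Q = z by apply: mul_add_div.
    by have -> : Nat.modulo (z * Q + y)%N Q = y by apply: mul_add_mod.
  rewrite -[Nat.pow 2 1]/2%N !big_ord_recr big_ord0 /= !E add0r -big_split mulr_sumr /=.
  apply: eq_bigr => y _.
  have c0 : 0 <= 2^-1 ^+ t :> K by rewrite exprn_ge0 // invr_ge0 ler0n.
  have h0 : 0 <= 2^-1 :> K by rewrite invr_ge0 ler0n.
  have half : 2^-1 * 2^-1 ^+ t = \sum_x q x * (2^-1 * 2^-1 ^+ t) by rewrite -mulr_suml q1 mul1r.
  have d0 : dd 0%N y = 2^-1 ^+ t * (2^-1 * \sum_x q x * (-1) ^+ Cf x y).
    rewrite /dd half -sumrB !mulr_sumr; apply: eq_bigr => x _.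
    by case: (Cf x y); rewrite /= ?expr0 ?expr1; field.
  have d1 : dd 1%N y = - (2^-1 ^+ t * (2^-1 * \sum_x q x * (-1) ^+ Cf x y)).
    rewrite /dd half -sumrB !mulr_sumr -sumrN; apply: eq_bigr => x _.
    by case: (Cf x y); rewrite /= ?expr0 ?expr1; field.
  by rewrite d1 d0 normrN !normrM (ger0_norm c0) (ger0_norm h0); field.
have c1 : (Q%:R * 2^-1 ^+ t = 1 :> K) by rewrite mulrC half_pow_mul.
have -> : \sum_(u < Q) `|\sum_x q x * (-1) ^+ Cf x u| =
    Q%:R * (trnorm (Nat.pow 2 1 * Q) A)%:K.
  by rewrite tA mulrA c1 mul1r.
rewrite mulrC; apply: ler_wpM2r; first exact: ler0n.
have : (trnorm (Nat.pow 2 1 * Q) A) <= 2%:R * eps.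
  by move: ext_le; rewrite RinvE real_IZR2 RmultE ler_pdivrMl // ltr0n.
by rewrite -lecR rmorphM rmorph_nat.
Qed.

(** * Min-entropy of a classical-quantum state, block by block *)

Section Source.
Variables (NA D : nat) (p : nat -> R) (rho : nat -> Mat).
Hypothesis cq : valid_cq NA D p rho.

Definition weighted (x : nat) : 'M[K]_D := (p x)%:K *: toM D (rho x).

Lemma weighted_psd x : (x < NA)%N -> psdmx (weighted x).
Proof.
case: cq => -[p0 _] rh xN; have /ssrnat.ltP xN' := xN.
apply: psdZ; last by have [] := density_toM (rh _ xN').
by rewrite ler0c; apply/RleP/p0.
Qed.

Lemma weighted_tr : \sum_(x < NA) \tr (weighted x) = 1.
Proof.
case: cq => -[_ p1] rh; rewrite -(rmorph1 (real_complex R)) -[1]/R1.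
have <- : Rsumn NA p = R1 by [].
rewrite Rsumn_sum rmorph_sum; apply: eq_bigr => x _; rewrite mxtraceZ.
by have [_ ->] := density_toM (rh x (elimT ssrnat.ltP (ltn_ord x))); rewrite mulr1.
Qed.

Lemma toM_marginal : toM D (marginalE NA p rho) = \sum_(x < NA) weighted x.
Proof. by rewrite toM_Msum; apply: eq_bigr => x _; rewrite toM_scale. Qed.

Lemma toM_cq : (0 < D)%N -> toM (NA * D) (cq_matrix NA D p rho) =
  \sum_(x < NA) (block_mx_at D (NA * D) x) ^t* *m weighted x *m block_mx_at D (NA * D) x.
Proof.
move=> D0; rewrite toM_Msum; apply: eq_bigr => x _.
by rewrite toM_scale toM_block // /weighted -scalemxAr -scalemxAl.
Qed.

Lemma source_dim : (0 < D)%N.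
Proof.
case: cq => pd rh; have [x [xN _]] := prob_dist_pos _ _ pd; have [_ t1] := rh x xN.
by move: t1; case: (D) => // /(congr1 Defs.Re)/esym/R1_neq_R0.
Qed.

(** Both sides are block diagonal in the classical register. Compressing to a block and embedding it
    back both preserve positivity. *)
Lemma loewner_blocks c sg : loewner_le (NA * D) (cq_matrix NA D p rho) (mscale c (kron D mid sg)) <->
  forall x, (x < NA)%N -> psdmx (c%:K *: toM D sg - weighted x).
Proof.
have D0 := source_dim; pose W := block_mx_at D (NA * D).
have E : toM (NA * D) (msub (mscale c (kron D mid sg)) (cq_matrix NA D p rho)) =
    \sum_(x < NA) (W x) ^t* *m (c%:K *: toM D sg - weighted x) *m W x.
  rewrite toM_sub toM_scale toM_kron_mid // toM_cq // scaler_sumr -sumrB.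
  by apply: eq_bigr => x _; rewrite mulmxBr mulmxBl; congr (_ - _); rewrite -scalemxAr -scalemxAl.
rewrite /loewner_le psd_toM E; split=> [h x xN|h].
  have := psd_congr (W (Ordinal xN)) h.
  by rewrite (block_compress (fun x => c%:K *: toM D sg - weighted x)).
apply: psd_sum => x _; have := psd_congr ((W x) ^t*) (h x (ltn_ord x)).
by rewrite trmxCK.
Qed.

(** The [epsilon] in [Hmin_q] means something only once the supremum is known to exist, so the set
    of achievable rates is first shown bounded and nonempty. *)
Lemma Hmin_q_witness k : Rle k (Hmin_q NA D (cq_matrix NA D p rho)) ->
  exists lam sg, [/\ Rlt (k - 1) lam, density D sg &
    forall x, (x < NA)%N -> psdmx ((Rpower 2 (- lam))%:K *: toM D sg - weighted x)].
Proof.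
pose E lam := exists sg, density D sg /\
  loewner_le (NA * D) (cq_matrix NA D p rho) (mscale (Rpower 2 (- lam)) (kron D mid sg)).
suff ex : exists h, is_lub E h.
  have := epsilon_spec (inhabits 0%R) (is_lub E) ex.
  move=> /lub_approx[lam [[sg [ds /loewner_blocks le]] ll]] kh.
  by exists lam, sg; split=> //; apply: Rle_lt_trans ll; apply: Rplus_le_compat_r.
have [x0 [xN px]] := prob_dist_pos _ _ (proj1 cq).
(* Taking traces in the block of an [x0] of positive probability gives [p x0 <= 2^-lam]. *)
have bE : bound E.
  exists (- log2 (p x0))%R => lam [sg [ds /loewner_blocks le]].
  apply: Rpower2_ge_inv => //; apply/RleP; rewrite -lecR -subr_ge0.
  have := psd_tr (le _ (introT ssrnat.ltP xN)).
  rewrite raddfB /= !mxtraceZ (proj2 (density_toM ds)).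
  by rewrite (proj2 (density_toM (proj2 cq _ xN))) !mulr1.
have [|h hh] := completeness E bE; last by exists h.
(* The rate 0 is always achieved by the marginal on [E], which dominates each of its summands. *)
exists 0%R, (marginalE NA p rho); split.
  split; last by apply: toK_inj; rewrite toM_tr toM_marginal raddf_sum; apply: weighted_tr.
  by apply/psd_toM; rewrite toM_marginal; apply: psd_sum => x _; apply: weighted_psd.
apply/loewner_blocks => x xN'; rewrite Ropp_0 Rpower_O; last exact: Rlt_0_2.
rewrite scale1r toM_marginal (bigD1 (Ordinal xN')) //= addrC addrK.
by apply: psd_sum => y _; apply: weighted_psd.
Qed.

End Source.

(** * The output state in blocks and its trace norm *)

Section Output.
Variables (n d m D : nat) (p : nat -> R) (rho : nat -> Mat) (Ext : nat -> nat -> nat).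
Hypothesis cq : valid_cq (Nat.pow 2 n) D p rho.
Hypothesis Ext_lt : forall x y, (Ext x y < Nat.pow 2 m)%N.

Let N := (Nat.pow 2 m * Nat.pow 2 d * D)%N.
Let W z y := block_mx_at D N (z * Nat.pow 2 d + y)%N.
Let B x z y : 'M[K]_N := (W z y) ^t* *m weighted D p rho x *m W z y.

Lemma toM_ext_out : toM N (ext_out_q n d D p rho Ext) =
  \sum_(x < Nat.pow 2 n) \sum_(y < Nat.pow 2 d) \sum_(z < Nat.pow 2 m)
    (2^-1 ^+ d * (z == Ext x y :> nat)%:R) *: B x z y.
Proof.
have D0 := source_dim cq.
rewrite toM_Msum; apply: eq_bigr => x _; rewrite toM_Msum; apply: eq_bigr => y _.
rewrite (bigD1 (Ordinal (Ext_lt x y))) //= big1 => [|z zE]; last first.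
  have -> : (z == Ext x y :> nat) = false.
    by apply/negbTE; apply: contra zE => /eqP h; apply/eqP/val_inj.
  by rewrite mulr0 scale0r.
rewrite addr0 eqxx mulr1 toM_scale rmorphM /= real_inv_pow.
have -> : toM N (kron D (kron (Nat.pow 2 d) (proj (Ext x y)) (proj y)) (rho x)) =
    toM N (kron D (proj (Ext x y * Nat.pow 2 d + y)%N) (rho x)).
  by apply/matrixP => i j; rewrite !mxE /kron -/(kron _ _ _ _ _) kron_proj.
rewrite toM_block // /B /weighted -scalemxAr -scalemxAl scalerA.
by congr (_ *: _); rewrite mulrC.
Qed.

Lemma toM_ideal : toM N (ideal_q n m d D p rho) =
  \sum_(x < Nat.pow 2 n) \sum_(y < Nat.pow 2 d) \sum_(z < Nat.pow 2 m)
    (2^-1 ^+ d * 2^-1 ^+ m) *: B x z y.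
Proof.
have D0 := source_dim cq.
have -> : toM N (ideal_q n m d D p rho) = (2^-1 ^+ d * 2^-1 ^+ m) *:
    toM N (kron D mid (marginalE (Nat.pow 2 n) p rho)).
  apply/matrixP => i j; rewrite !mxE /ideal_q {1}/kron toKM /ideal_cl toK_kron_mid.
  rewrite /kron toKM toK_mid mulrA; congr (_ * _ * _).
  by rewrite rmorphM /= !real_inv_pow mulrC.
rewrite toM_kron_mid // toM_marginal.
pose F a := (block_mx_at D N a) ^t* *m (\sum_(x < Nat.pow 2 n) weighted D p rho x) *m
  block_mx_at D N a.
rewrite (sum_ord_mul (Nat.pow 2 m) (Nat.pow 2 d) F) exchange_big scaler_sumr [RHS]exchange_big.
apply: eq_bigr => y _; rewrite scaler_sumr [RHS]exchange_big; apply: eq_bigr => z _.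
by rewrite /F -/(W z y) mulmx_sumr mulmx_suml scaler_sumr.
Qed.

(** Only the diagonal blocks of the optimal [T] meet a block-diagonal difference. The factor [2^d]
    cancels the probability of a seed. *)
Lemma output_trnorm : exists2 T : nat -> nat -> 'M[K]_D, (forall z y, contraction (T z y)) &
  (trnorm N (msub (ext_out_q n d D p rho Ext) (ideal_q n m d D p rho)))%:K * (Nat.pow 2 d)%:R =
  \sum_(x < Nat.pow 2 n) \sum_(y < Nat.pow 2 d) \sum_(z < Nat.pow 2 m)
    ((z == Ext x y :> nat)%:R - 2^-1 ^+ m) * \tr (weighted D p rho x *m T z y).
Proof.
set A := msub _ _.
have EA : toM N A = \sum_(x < Nat.pow 2 n) \sum_(y < Nat.pow 2 d) \sum_(z < Nat.pow 2 m)
    (2^-1 ^+ d * ((z == Ext x y :> nat)%:R - 2^-1 ^+ m)) *: B x z y.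
  rewrite toM_sub toM_ext_out toM_ideal -sumrB; apply: eq_bigr => x _.
  rewrite -sumrB; apply: eq_bigr => y _; rewrite -sumrB; apply: eq_bigr => z _.
  by rewrite -scalerBl mulrBr.
have real_half i : (2^-1 ^+ i : K)^* = 2^-1 ^+ i.
  by rewrite rmorphXn fmorphV rmorph_nat.
have hA : hermmx (toM N A).
  rewrite EA /hermmx trmxC_sum; apply: eq_bigr => x _.
  rewrite trmxC_sum; apply: eq_bigr => y _; rewrite trmxC_sum; apply: eq_bigr => z _.
  rewrite trmxCZ rmorphM rmorphB /= !real_half rmorph_nat; congr (_ *: _).
  rewrite /B !trmxCM trmxCK mulmxA; congr (_ *m _ *m _); apply: psd_herm.
  by apply: (weighted_psd cq).
have [T cT ->] := trnorm_herm hA.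
(* The compression of [T] to block [(z, y)]. Outside the range it is set to 0, so that every
   [T' z y] is a contraction. *)
pose T' z y := if (z < Nat.pow 2 m)%N && (y < Nat.pow 2 d)%N
  then W z y *m T *m (W z y) ^t* else 0.
exists T'.
  move=> z y; rewrite /T'; case: ifP => [/andP[zm yd]|_]; last exact: contraction0.
  apply: contraction_compress => //; rewrite block_ortho ?eqxx //.
  rewrite leq_mul2r; apply/orP; right.
  apply: leq_trans (_ : (z.+1 * Nat.pow 2 d <= _)%N); first by rewrite mulSnr ltn_add2l.
  by rewrite leq_mul2r zm orbT.
rewrite EA mulmx_suml raddf_sum mulr_suml; apply: eq_bigr => x _.
rewrite mulmx_suml raddf_sum /= mulr_suml; apply: eq_bigr => y _.
rewrite mulmx_suml raddf_sum /= mulr_suml; apply: eq_bigr => z _.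
rewrite -scalemxAl mxtraceZ /T' !ltn_ord /= /B.
rewrite -!mulmxA [\tr ((W z y) ^t* *m _)]mxtrace_mulC !mulmxA.
by rewrite mulrAC [2^-1 ^+ d * _]mulrC -[_ * 2^-1 ^+ d * _]mulrA half_pow_mul mulr1.
Qed.

End Output.

Lemma design_rate (S : nat -> list nat) r m i : (i < m)%N ->
  Rle (Rsumn i (fun j => pow 2 (inter_size (S j) (S i)))) (r * INR m) ->
  Rle (INR (\sum_(j < i) 2 ^ inter_size (S j) (S i))) (r * INR m).
Proof.
move=> im; rewrite Rsumn_sum [INR (\sum_(j < i) _)]INRE natr_sum; congr (Rle _ _); apply: eq_bigr => j _.
by rewrite RpowE natrX.
Qed.

Lemma trevisan_trnorm_le (n t d m D : nat) (Cf : nat -> nat -> bool) (S : nat -> list nat)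
    (k eps r : R) (p : nat -> R) (rho : nat -> Mat) :
  Rlt 0 eps -> strong_ext n t 1 (fun x y => Nat.b2n (Cf x y)) k eps ->
  weak_design d t r m S -> valid_cq (Nat.pow 2 n) D p rho ->
  Rle (Rplus (Rplus k (Rmult r (INR m))) (log2 (Rinv eps)))
    (Hmin_q (Nat.pow 2 n) D (cq_matrix (Nat.pow 2 n) D p rho)) ->
  Rle (trnorm (Nat.pow 2 m * Nat.pow 2 d * D)
    (msub (ext_out_q n d D p rho (trevisan Cf S m)) (ideal_q n m d D p rho)))
    (Rmult (INR m) (Rmult 3 (sqrt eps))).
Proof.
move=> eps_gt0 ext des cq /(Hmin_q_witness cq)[lam [sg [lam_gt dsg le_sg]]].
have Ext_lt x y : (trevisan Cf S m x y < Nat.pow 2 m)%N by apply/ssrnat.ltP/trevisan_lt.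
have [T cT trE] := output_trnorm d cq Ext_lt.
set tn := trnorm _ _ in trE *.
have [psg tsg] := density_toM dsg.
have wp (x : 'I_(Nat.pow 2 n)) := weighted_psd cq (ltn_ord x).
have eps0 : 0 <= eps%:K by rewrite ler0c; apply/RleP/Rlt_le.
have sqrt_eps : sqrtC (eps%:K) = (sqrt eps)%:K.
  rewrite -{1}(sqrt_sqrt _ (Rlt_le _ _ eps_gt0)) RmultE rmorphM -expr2 sqrCK //.
  by rewrite ler0c; apply/RleP/sqrt_pos.
have : tn%:K * (Nat.pow 2 d)%:R <= m%:R * (3 * sqrtC (eps%:K) * (Nat.pow 2 d)%:R).
  rewrite trE; apply: (trevisan_bound (t := t) (kap := (Rpower 2 (- k))%:K)
    wp (weighted_tr cq) tsg psg (fun x => le_sg x (ltn_ord x)) cT).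
  - by rewrite ltcE /= eqxx; apply/RltP/exp_pos.
  - by rewrite ltcE /= eqxx; apply/RltP.
  - exact: strong_ext_sum ext.
  - move=> i im; have [Si [St [Sd _]]] := des i (elimT ssrnat.ltP im).
    by split=> //; apply: Sorted_lt_NoDup.
  (* The design bounds the number of advice bits by [r m]; with [lam] within one bit of the assumed
     min-entropy, this is the budget [2 kap e]. *)
  - move=> i im; have [_ [_ [_ rate]]] := des i (elimT ssrnat.ltP im).
    have /RleP := Rpower2_rate k (r * INR m) eps lam _ eps_gt0 (design_rate im rate) lam_gt.
    by rewrite RpowE real_IZR2 -lecR !rmorphM rmorphXn !rmorph_nat natrX.
have p0 : 0 < (Nat.pow 2 d)%:R :> K by rewrite Nat_pow_expn ltr0n expn_gt0.
rewrite sqrt_eps mulrA ler_pM2r // -!(rmorph_nat (real_complex R)) -!rmorphM lecR.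
by move=> /RleP; rewrite INRE.
Qed.

End Bridge.

Theorem mainTheorem3 (n t d m : nat) (C : nat -> nat -> bool)
    (S : nat -> list nat) (k eps r : R) :
  0 < eps ->
  strong_ext n t 1 (fun x y => Nat.b2n (C x y)) k eps ->
  weak_design d t r m S ->
  qproof_strong_ext n d m (trevisan C S m)
    (k + r * INR m + log2 (/ eps)) (3 * INR m * sqrt eps).
Proof.
move=> eps_gt0 ext des D p rho cq Hk.
have h : trnorm (Nat.mul (Nat.mul (Nat.pow 2 m) (Nat.pow 2 d)) D) (msub (ext_out_q n d D p rho (trevisan C S m))
    (ideal_q n m d D p rho)) <= INR m * (3 * sqrt eps) := trevisan_trnorm_le eps_gt0 ext des cq Hk.
(* [h] already bounds the full trace norm, so halving it stays below the claimed error once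
   [m sqrt eps] is known to be nonnegative. *)
have := Rmult_le_pos _ _ (pos_INR m) (sqrt_pos eps).
Lra.lra.
Qed.
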